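(* Under assumptions $(A_1)$, $(A_2)$, $(A_3)$ (stated in the context), the following conclusions are true: (i) If system $[A,B]$ is stabilizable, then the pair $(A^*,B^* )$ satisfies (HESI)$_\beta$ for some $\beta>0$. (ii) If system $[A,B]$ is rapidly stabilizable, then the pair $(A^*,B^* )$ satisfies (HESI).
   Context: Notation. $\mathbb{R}^+=(0,+\infty)$; for $\gamma\in\mathbb{R}$, $\mathbb{C}_\gamma^+=\{z\in\mathbb{C}:\mathrm{Re}\,z>\gamma\}$. $\rho(L)$, $L^*$ and $D(L)$ denote the resolvent set, adjoint and domain of an operator $L$; $\mathcal{L}(X_1;X_2)$ is the space of bounded linear operators from $X_1$ to $X_2$, and $\mathcal{L}(X)=\mathcal{L}(X;X)$. Control system. $H$ and $U$ are separable complex Hilbert spaces. System $[A,B]$ is $y'(t)=Ay(t)+Bu(t)$, $t\in\mathbb{R}^+$, with control $u\in L^2(\mathbb{R}^+;U)$. Assumptions: $(A_1)$ $A$ with domain $D(A)$ generates a $C_0$-semigroup $S(\cdot)$ on $H$. $(A_2)$ $B\in\mathcal{L}(U;H_{-1})$, where $H_{-1}$ is the completion of $H$ with respect to the norm $\|f\|_{-1}:=\|(\rho_0I-A)^{-1}f\|_H$, with $\rho_0\in\rho(A)\cap\mathbb{R}^+$ arbitrarily fixed. $(A_3)$ For each $T>0$ there is $C(T)>0$ such that $\int_0^T\|B^*S^*(t)\varphi\|_U^2\,dt\le C(T)\|\varphi\|_H^2$ for all $\varphi\in D(A^* )$. $H_1$ denotes $D(A^* )$ with the norm $\|(\rho_0I-A^*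 )\varphi\|_H$; $H_{-1}$ is the dual of $H_1$ with respect to the pivot space $H$, and $B^*\in\mathcal{L}(H_1;U)$ is the corresponding adjoint of $B$. $\widetilde A\in\mathcal{L}(H;H_{-1})$ is the unique extension of $A$, given by $\langle\widetilde A\varphi,\psi\rangle_{H_{-1},H_1}=\langle\varphi,A^*\psi\rangle_H$ for $\varphi\in H$, $\psi\in H_1$. Stabilizability. System $[A,B]$ is stabilizable with decay rate $\alpha>0$ if there are a $C_0$-semigroup $\mathcal{S}_\dag(\cdot)$ on $H$ with generator $\mathcal{A}_\dag:D(\mathcal{A}_\dag)\subset H\to H$ and an operator $K_\dag\in\mathcal{L}(D(\mathcal{A}_\dag);U)$ (with $D(\mathcal{A}_\dag)$ carrying the graph norm) such that: (a) there is $C_1>0$ with $\|\mathcal{S}_\dag(t)\|_{\mathcal{L}(H)}\le C_1e^{-\alpha t}$ for all $t\in\mathbb{R}^+$; (b) $\mathcal{A}_\dag x=\widetilde Ax+BK_\dag x$ for each $x\in D(\mathcal{A}_\dag)$; (c) there is $C_2>0$ with $\|K_\dag\mathcal{S}_\dag(\cdot)x\|_{L^2(\mathbb{R}^+;U)}\le C_2\|x\|_H$ for each $x\in D(\mathcal{A}_\dag)$. System $[A,B]$ is (exponentially) stabilizable if it is stabilizable with decay rate $\alpha$ for some $\alpha>0$; it is rapidly stabilizable if it is stabilizable with decay rate $\alpha$ for every $\alpha>0$. Frequency-domain condition. For $\beta>0$, the pair $(A^*,B^* )$ satisfies (HESI)$_\beta$ if there exists $C(\beta)>0$ such that $$\|\varphi\|_H^2\le\frac{C(\beta)}{(\mathrm{Re}\,\lambda+\beta)^2}\left(\|(\lambda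 I-A^* )\varphi\|_H^2+\|B^*\varphi\|_U^2\right)\quad\text{for all }\lambda\in\mathbb{C}_{-\beta}^+,\ \varphi\in H_1.$$ The pair satisfies (HESI) if it satisfies (HESI)$_\beta$ for each $\beta>0$. *)

(* Defs.v *)
From HB Require Import structures.
From mathcomp Require Import all_boot all_order all_algebra.
From mathcomp Require Import all_classical all_reals all_analysis.
From mathcomp Require Import complex.
Import numFieldNormedType.Exports.
Import Order.TTheory GRing.Theory Num.Theory.

Set Implicit Arguments.
Unset Strict Implicit.
Unset Printing Implicit Defensive.

Local Open Scope classical_set_scope.
Local Open Scope complex_scope.
Local Open Scope ring_scope.

(* The inner product is linear in its first argument and conjugate-linear in
   the second; the norm `|x| takes values in R[i], hence normR below. *)
HB.mixin Record CompleteNormedModule_isHilbert (R : realType) H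
    of CompleteNormedModule R[i] H := {
  inner : {dot H for (@Num.conj R[i])};
  inner_norm : forall x : H, `|x| ^+ 2 = inner x x
}.

#[short(type="hilbertType")]
HB.structure Definition Hilbert (R : realType) :=
  {H of CompleteNormedModule_isHilbert R H & CompleteNormedModule R[i] H}.

Arguments inner {R s}.

Definition normR (R : realType) (V : normedModType R[i]) (x : V) : R :=
  complex.Re `|x|.

Definition separable (T : topologicalType) :=
  exists2 Q : set T, countable Q & dense Q.

(* Only the values of opfun on dom are meaningful. *)
Record operator (X Y : Type) := Operator { dom : set X; opfun :> X -> Y }.

Section Operators.
Variables (R : realType) (H : hilbertType R).
Implicit Types (L : operator H H) (S : R -> {linear H -> H}).

(* adjoint_graph L y is at most a singleton when dom L is dense, as it is for
   every generator; xget 0 returns its element, or 0 when there is none. *)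
Definition adjoint_graph L (y : H) : set H :=
  [set z | forall x, dom L x -> inner (L x) y = inner x z].

Definition adjoint L : operator H H :=
  {| dom := [set y | adjoint_graph L y !=set0];
     opfun := fun y => xget 0 (adjoint_graph L y) |}.

Definition resolvent L (lambda : R[i]) (f : H) : H :=
  xget 0 [set x | dom L x /\ lambda *: x - L x = f].

Definition resolvent_set L : set R[i] :=
  [set lambda | set_bij (dom L) setT (fun x => lambda *: x - L x) /\
    exists M : R, forall f, normR (resolvent L lambda f) <= M * normR f].

(* S t is constrained only for t >= 0. *)
Definition C0_semigroup S :=
  [/\ forall t, 0 <= t -> continuous (S t),
      forall x, S 0 x = x,
      forall s t x, 0 <= s -> 0 <= t -> S (s + t) x = S s (S t x)
    & forall x, S t x @[t --> 0^'+] --> x].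

Definition generates L S := forall x y : H,
  dom L x /\ L x = y <-> (h^-1)%:C *: (S h x - x) @[h --> 0^'+] --> y.

Definition graph_norm L (x : H) : R := normR x + normR (L x).

Definition bounded_on_domain (U : hilbertType R) L (K : H -> U) :=
  (forall (a : R[i]) x y, dom L x -> dom L y ->
     K (a *: x + y) = a *: K x + K y) /\
  exists M : R, forall x, dom L x -> normR (K x) <= M * graph_norm L x.

End Operators.

Section ControlSystem.
Variables (R : realType) (H U : hilbertType R).
Variables (Hm1 : completeNormedModType R[i]) (j : {linear H -> Hm1}).
Variables (A : operator H H) (B : {linear U -> Hm1}).

(* Hm1, with the embedding j, is the completion of H for the norm
   f |-> normR (resolvent A rho0 f). *)
Definition extrapolation_space (rho0 : R) :=
  (forall f, normR (j f) = normR (resolvent A rho0%:C f)) /\ dense (range j).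

(* The pairing <e, psi> of H_{-1} with H_1 := D(A^* ), obtained by extending
   the inner product of H by continuity in e; (R[i])^o carries the topology. *)
Definition pairing (e : Hm1) (psi : H) : R[i] :=
  xget 0 [set z : R[i] | forall f : nat -> H,
    j (f n) @[n --> \oo] --> e ->
    (inner (f n) psi : (R[i])^o) @[n --> \oo] --> (z : (R[i])^o)].

(* The extension of A to a bounded operator from H to H_{-1}. *)
Definition extension (x : H) : Hm1 :=
  xget 0 [set e | forall psi, dom (adjoint A) psi ->
    pairing e psi = inner x (adjoint A psi)].

(* B^* : H_1 -> U; its values are meaningful on D(A^* ) only. *)
Definition control_adjoint (phi : H) : U :=
  xget 0 [set v | forall u, pairing (B u) phi = inner u v].

Definition admissible (S : R -> {linear H -> H}) :=
  forall T : R, 0 < T -> exists2 C : R, 0 < C &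
    forall phi, dom (adjoint A) phi ->
    (\int[lebesgue_measure]_(t in `[0%R, T])
       (normR (control_adjoint (adjoint (Operator setT (S t)) phi)) ^+ 2)%:E
     <= (C * normR phi ^+ 2)%:E)%E.

Definition L2norm (f : R -> U) : \bar R :=
  ((\int[lebesgue_measure]_(t in `]0%R, +oo[) (normR (f t) ^+ 2)%:E)
     `^ 2^-1)%E.

Definition stabilizable_with_rate (alpha : R) :=
  exists (S : R -> {linear H -> H}) (L : operator H H) (K : H -> U),
  [/\ C0_semigroup S /\ generates L S,
      bounded_on_domain L K,
      exists2 C1 : R, 0 < C1 & forall t, 0 < t -> forall x,
        normR (S t x) <= C1 * expR (- alpha * t) * normR x,
      forall x, dom L x -> j (L x) = extension x + B (K x)
    & exists2 C2 : R, 0 < C2 & forall x, dom L x ->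
        (L2norm (fun t => K (S t x)) <= (C2 * normR x)%:E)%E].

Definition stabilizable :=
  exists2 alpha : R, 0 < alpha & stabilizable_with_rate alpha.

Definition rapidly_stabilizable :=
  forall alpha : R, 0 < alpha -> stabilizable_with_rate alpha.

Definition HESI_at (beta : R) :=
  exists2 C : R, 0 < C & forall (lambda : R[i]) (phi : H),
    - beta < complex.Re lambda -> dom (adjoint A) phi ->
    normR phi ^+ 2 <= C / (complex.Re lambda + beta) ^+ 2 *
      (normR (lambda *: phi - adjoint A phi) ^+ 2 +
       normR (control_adjoint phi) ^+ 2).

Definition HESI := forall beta : R, 0 < beta -> HESI_at beta.

End ControlSystem.

(* Main.v *)
Require Import Defs.
From mathcomp Require Import all_boot all_order all_algebra.
From mathcomp Require Import all_classical all_reals all_analysis.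
From mathcomp Require Import measurable_realfun complex ring lra.
Import numFieldNormedType.Exports.
Import Order.TTheory GRing.Theory Num.Theory.

Set Implicit Arguments.
Unset Strict Implicit.
Unset Printing Implicit Defensive.

Local Open Scope classical_set_scope.
Local Open Scope complex_scope.
Local Open Scope ring_scope.

(** For a closed-loop orbit starting at x in the domain of the stabilizing
    generator L, the function z(t) = <S(t) x, phi> satisfies, when phi lies in
    the domain of A^*,
      z' = conj(lambda) z - <S(t) x, lambda phi - A^* phi> + <K S(t) x, B^* phi>,
    because L acts as the extension of A plus B K ([closed_loop_duality]). The
    weighted energy exp(-2 Re(lambda) t) |z(t)|^2 therefore decreases at a rate
    controlled by the two quantities on the right of the resolvent inequality
    ([is_derive_energy]). If Re lambda > -beta with beta < alpha, the decay of
    the closed loop makes the energy at a fixed time T at most half of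
    |x|^2 |phi|^2, while the square-integrable output bounds the contribution of
    B^* phi on [0, T]; letting x tend to phi, which is possible because the domain
    of a generator is dense ([dense_generator], [density_test]), gives
      |phi|^2 <= D (|lambda phi - A^* phi|^2 + |B^* phi|^2)
    with D independent of lambda ([damped_estimate]).

    This settles every bounded range of Re lambda, but lacks the factor
    (Re lambda + beta)^-2 as Re lambda grows. There the same computation with the
    uncontrolled semigroup of A and without output gives
    |phi| <= C |lambda phi - A^* phi| / Re lambda ([high_frequency_estimate]).
    Together they yield the inequality for every beta < alpha
    ([stabilizable_HESI]), hence both conclusions.

    Three tools support the computation. Uniform boundedness makes a strongly
    continuous semigroup locally bounded, hence its orbits continuous on the line.
    Riesz representation gives orbits an integral, defined through its inner
    products, and these integrals lie in the domain of the generator. Riesz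
    representation on the control space and the isometry of the extrapolation
    space onto H give the pairing, the extension of A and B^* their usual
    characterizations ([pairing_lifts], [extensionP], [control_adjointP]). *)

(** * Norms and inner products with real values *)

Section RealNorm.
Variables (R : realType) (V : normedModType R[i]).
Implicit Types x y : V.

Lemma norm_normR x : `|x| = (normR x)%:C.
Proof.
have := normr_ge0 x; rewrite /normR; case: (`|x|) => a b.
by rewrite lecE /= => /andP[/eqP -> _].
Qed.

Lemma normR_ge0 x : 0 <= normR x.
Proof. by have := normr_ge0 x; rewrite norm_normR ler0c. Qed.

Lemma normR0 : normR (0 : V) = 0.
Proof. by rewrite /normR normr0. Qed.

Lemma normR0_eq0 x : normR x = 0 -> x = 0.
Proof. by move=> x0; apply/normr0_eq0; rewrite norm_normR x0. Qed.

Lemma normRN x : normR (- x) = normR x.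
Proof. by rewrite /normR normrN. Qed.

Lemma normRB x y : normR (x - y) = normR (y - x).
Proof. by rewrite -normRN opprB. Qed.

Lemma normRD x y : normR (x + y) <= normR x + normR y.
Proof. by have := ler_normD x y; rewrite !norm_normR -rmorphD lecR. Qed.

Lemma normR_triangle x y z : normR (x - z) <= normR (x - y) + normR (y - z).
Proof. by rewrite -[x - z](subrKA y); exact: normRD. Qed.

Lemma normRZ (a : R[i]) x : normR (a *: x) = complex.Re `|a| * normR x.
Proof. by rewrite /normR normrZ norm_normR normc_def -rmorphM. Qed.

Lemma normRZr (a : R) x : normR (a%:C *: x) = `|a| * normR x.
Proof. by rewrite normRZ normc_def /= expr0n addr0 sqrtr_sqr. Qed.

Lemma cvg_normRP (T : Type) (F : set_system T) (FF : Filter F) (f : T -> V) l :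
  f @ F --> l <-> forall e : R, 0 < e -> \forall t \near F, normR (f t - l) < e.
Proof.
split=> [/cvgrPdist_lt fl e e0|fl].
  have /fl : (0 : R[i]) < e%:C by rewrite ltcR.
  by apply: filterS => t; rewrite norm_normR ltcR normRB.
apply/cvgrPdist_lt => -[a b]; rewrite ltcE /= => /andP[/eqP -> a0].
by apply: filterS (fl _ a0) => t; rewrite norm_normR ltcR normRB.
Qed.

End RealNorm.

Lemma complete_normR (R : realType) (V : completeNormedModType R[i])
    (u : nat -> V) :
  (forall e : R, 0 < e -> exists N, forall m n, (N <= m)%N -> (N <= n)%N ->
    normR (u m - u n) < e) ->
  exists l : V, u n @[n --> \oo] --> l.
Proof.
move=> cu; suff : cauchy (fmap u \oo).
  by move=> /cauchy_cvgP/cvg_ex.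
apply/cauchy_exP => -[a b]; rewrite ltcE /= => /andP[/eqP -> a0].
have [N uN] := cu _ a0; exists (u N), N => // n /= Nn.
by rewrite -ball_normE /= norm_normR ltcR uN.
Qed.

(** Bounds on this real inner product transfer to [inner], whose imaginary part
    is again a real inner product, by [innerE]. *)
Definition rin (R : realType) (H : hilbertType R) (x y : H) : R :=
  complex.Re (inner x y).

Section RealInner.
Variables (R : realType) (H : hilbertType R).
Implicit Types x y z : H.

Lemma rinC x y : rin x y = rin y x.
Proof.
rewrite /rin hermC /= expr0 mul1r; case: (inner y x) => a b.
by rewrite -[_^*%R]/(conjc _).
Qed.

Lemma rinDl x y z : rin (x + y) z = rin x z + rin y z.
Proof. by rewrite /rin linearDl /= raddfD. Qed.

Lemma rinNl x z : rin (- x) z = - rin x z.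
Proof. by rewrite /rin linearNl /= raddfN. Qed.

Lemma rinZl (a : R) x z : rin (a%:C *: x) z = a * rin x z.
Proof.
by rewrite /rin linearZl_LR /=; case: (inner x z) => b c /=; rewrite mul0r subr0.
Qed.

Lemma rinBl x y z : rin (x - y) z = rin x z - rin y z.
Proof. by rewrite rinDl rinNl. Qed.

Lemma rinDr x y z : rin z (x + y) = rin z x + rin z y.
Proof. by rewrite !(rinC z) rinDl. Qed.

Lemma rinBr x y z : rin z (x - y) = rin z x - rin z y.
Proof. by rewrite !(rinC z) rinBl. Qed.

Lemma rinZr (a : R) x z : rin z (a%:C *: x) = a * rin z x.
Proof. by rewrite !(rinC z) rinZl. Qed.

Lemma rin0l x : rin 0 x = 0.
Proof. by rewrite /rin linear0l. Qed.

Lemma rin_norm x : rin x x = normR x ^+ 2.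
Proof. by rewrite /rin -inner_norm norm_normR -rmorphXn. Qed.

Lemma innerE x y : inner x y = Complex (rin x y) (rin x ('i%C *: y)).
Proof.
rewrite /rin linearZr_LR /=; case: (inner x y) => a b.
rewrite -['i%C^*%R]/(conjc 'i%C) /=; congr Complex; ring.
Qed.

Lemma normRD_sqr x y :
  normR (x + y) ^+ 2 = normR x ^+ 2 + 2 * rin x y + normR y ^+ 2.
Proof. by rewrite -!rin_norm !(rinDl, rinDr) (rinC y x); ring. Qed.

Lemma normRB_sqr x y :
  normR (x - y) ^+ 2 = normR x ^+ 2 - 2 * rin x y + normR y ^+ 2.
Proof. by rewrite -!rin_norm !(rinBl, rinBr) (rinC y x); ring. Qed.

Lemma rin_le x y : rin x y <= normR x * normR y.
Proof.
have [y0|y0] := eqVneq (normR y) 0.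
  by rewrite (normR0_eq0 y0) rinC rin0l normR0 mulr0.
have [x0|x0] := eqVneq (normR x) 0.
  by rewrite (normR0_eq0 x0) rin0l normR0 mul0r.
have yp : 0 < normR y by rewrite lt_def y0 normR_ge0.
have xp : 0 < normR x by rewrite lt_def x0 normR_ge0.
have := sqr_ge0 (normR ((normR y)%:C *: x - (normR x)%:C *: y)).
rewrite normRB_sqr rinZl rinZr !normRZr !ger0_norm ?normR_ge0//.
rewrite (_ : _ + _ = 2 * (normR x * normR y) * (normR x * normR y - rin x y)).
  by rewrite pmulr_rge0 ?subr_ge0// !mulr_gt0.
by ring.
Qed.

Lemma rin_norm_le x y : `|rin x y| <= normR x * normR y.
Proof.
by rewrite ler_norml rin_le andbT lerNl -rinNl -(normRN x) rin_le.
Qed.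

Lemma normR_i x : normR ('i%C *: x) = normR x.
Proof. by rewrite normRZ normc_def /= expr0n expr1n add0r sqrtr1 mul1r. Qed.

(** Testing x against itself suffices. *)
Lemma normR_dual_le x (e : R) : 0 <= e ->
  (forall y, rin x y <= e * normR y) -> normR x <= e.
Proof.
move=> e0 xe; have [x0|x0] := eqVneq (normR x) 0; first by rewrite x0.
have xp : 0 < normR x by rewrite lt_def x0 normR_ge0.
by have := xe x; rewrite rin_norm expr2 ler_pM2r.
Qed.

End RealInner.

(** * Riesz representation and uniform boundedness *)

Lemma inv_succ_lt (R : realType) (e : R) : 0 < e ->
  exists N : nat, forall n, (N <= n)%N -> n.+1%:R^-1 < e.
Proof.
move=> e0; exists (Num.bound e^-1) => n Nn.
rewrite invf_plt ?posrE ?ltr0n//.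
rewrite (lt_le_trans (archi_boundP _)) ?invr_ge0 ?(ltW e0)//.
by rewrite ler_nat ltnW.
Qed.

Section Riesz.
Variables (R : realType) (H : hilbertType R).

(** The representing vector minimises |u|^2 - 2 l(u). The statement is over the
    real scalars so that it also applies to real parts of integrals. *)
Lemma riesz (l : H -> R) (M : R) :
  (forall x y, l (x + y) = l x + l y) ->
  (forall (a : R) x, l (a%:C *: x) = a * l x) ->
  (forall x, `|l x| <= M * normR x) ->
  exists v, forall x, l x = rin x v.
Proof.
move=> lD lZ lM.
pose J u := normR u ^+ 2 - 2 * l u.
have lN x : l (- x) = - l x.
  by rewrite -scaleN1r -(rmorphN1 (real_complex R)) lZ mulN1r.
have J_ge u : - M ^+ 2 <= J u.
  have := lM u; rewrite ler_norml => /andP[_ lu].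
  by have := sqr_ge0 (normR u - M); rewrite /J; nra.
have infJ : has_inf (range J).
  by split; [exists (J 0); exists 0 | exists (- M ^+ 2) => _ [u _ <-]].
pose m := inf (range J).
have mJ u : m <= J u by apply: ge_inf; [exact: infJ.2 | exists u].
have JuD u w : J (u + w) = J u + 2 * (rin u w - l w) + normR w ^+ 2.
  by rewrite /J normRD_sqr lD; ring.
have /choice [u Ju] : forall n : nat, exists u, J u < m + n.+1%:R^-1.
  move=> n.
  have [||_ [u _ <-] Ju] := @inf_adherent _ (range J) n.+1%:R^-1.
  - by rewrite invr_gt0 ltr0n.
  - exact: infJ.
  - by exists u.
(* The parallelogram identity makes near-minimisers close to each other. *)
have par a b : normR (a - b) ^+ 2 <= 2 * (J a - m) + 2 * (J b - m).
  have := mJ ((2^-1 : R)%:C *: (a + b)).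
  rewrite /J normRZr lZ exprMn real_normK ?num_real// normRD_sqr normRB_sqr lD.
  lra.
have [v uv] : exists v : H, u n @[n --> \oo] --> v.
  apply: complete_normR => e e0.
  have [|N uN] := inv_succ_lt (e := e ^+ 2 / 4); first by rewrite divr_gt0 ?exprn_gt0.
  exists N => a b Na Nb.
  rewrite -(ltr_pXn2r (n := 2)) ?nnegrE ?normR_ge0 ?(ltW e0)//.
  apply: le_lt_trans (par _ _) _.
  have Jn k : (N <= k)%N -> J (u k) - m < e ^+ 2 / 4.
    by move=> Nk; rewrite ltrBlDl (lt_trans (Ju k))// ltrD2l uN.
  by have := Jn _ Na; have := Jn _ Nb; lra.
exists v => x; rewrite rinC.
pose c := rin v x - l x; pose a := normR x ^+ 2.
have a0 : 0 <= a by exact: sqr_ge0.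
(* The quadratic t |-> |x|^2 t^2 + 2 c t is nonnegative, so c vanishes; the value
   t = - c / (a + 1) avoids dividing by a. *)
suff Hc t : 0 <= t ^+ 2 * a + 2 * t * c.
  have c0 : c ^+ 2 <= 0.
    have a1 : 0 < a + 1 by lra.
    have := Hc (- c / (a + 1)).
    rewrite (_ : _ + _ = - (c ^+ 2 * (a + 2)) / (a + 1) ^+ 2); last first.
      by field; rewrite gt_eqF.
    rewrite pmulr_lge0 ?invr_gt0 ?exprn_gt0// oppr_ge0 pmulr_lle0//; lra.
  have : c == 0 by rewrite -sqrf_eq0 eq_le c0 sqr_ge0.
  by rewrite subr_eq0 => /eqP.
apply/ler_addgt0Pr => e e0.
pose K := 1 + 2 * `|t| * normR x.
have K0 : 0 < K by rewrite ltr_wpDr ?mulr_ge0 ?normR_ge0.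
have e'0 : 0 < e / K by rewrite divr_gt0.
have [N uN] := inv_succ_lt e'0.
have [N' _ uN'] := (cvg_normRP _ _ _).1 uv _ e'0.
set n := maxn N N'.
have un : normR (u n - v) <= e / K by apply/ltW/uN' => /=; rewrite leq_maxr.
have nN : n.+1%:R^-1 < e / K by apply: uN; rewrite leq_maxl.
have := mJ (u n + t%:C *: x).
rewrite JuD normRZr rinZr lZ exprMn real_normK ?num_real//.
have h1 : `|t * rin (u n - v) x| <= `|t| * (e / K * normR x).
  rewrite normrM ler_wpM2l// (le_trans (rin_norm_le _ _))// ler_wpM2r ?normR_ge0//.
have h2 : t * rin (u n) x = t * rin v x + t * rin (u n - v) x by rewrite rinBl; ring.
have h3 : e = e / K + 2 * (`|t| * (e / K * normR x)).
  have -> : e / K + 2 * (`|t| * (e / K * normR x)) = e / K * K.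
    by rewrite /K; ring.
  by rewrite divfK ?gt_eqF.
move: h1; rewrite ler_norml => /andP[_ h1].
have h4 : J (u n) < m + e / K by rewrite (lt_trans (Ju n))// ltrD2l.
by rewrite -/a /c; lra.
Qed.

End Riesz.

Section UniformBoundedness.
Variables (R : realType) (V W : completeNormedModType R[i]).

Lemma continuous_linear_normR (T : {linear V -> W}) : continuous T ->
  exists2 C : R, 0 < C & forall x, normR (T x) <= C * normR x.
Proof.
move=> /(_ 0) /cvg_normRP /(_ 1 ltr01).
rewrite nearE -nbhs_ballE => -[[a b]]; rewrite /= ltcE /= => /andP[/eqP -> a0] aT.
exists (2 / a); first by rewrite divr_gt0.
move=> x; have [x0|x0] := eqVneq (normR x) 0.
  by rewrite (normR0_eq0 x0) linear0 !normR0 mulr0.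
have xp : 0 < normR x by rewrite lt_def x0 normR_ge0.
have : ball (0 : V) a%:C ((a / 2 / normR x)%:C *: x).
  rewrite -ball_normE /= sub0r norm_normR ltcR normRN normRZr ger0_norm; last first.
    by rewrite !divr_ge0 ?normR_ge0 ?ltW.
  by rewrite divfK// gtr_pMr// invf_lt1// ltr1n.
move/aT => /=; rewrite linear0 subr0 linearZ /= normRZr ger0_norm; last first.
  by rewrite !divr_ge0 ?normR_ge0 ?ltW.
move=> /ltW h; rewrite -(ler_pM2l (x := a / 2 / normR x)) ?divr_gt0//.
rewrite (le_trans h)// le_eqVlt; apply/orP; left; apply/eqP.
by field; rewrite x0 gt_eqF.
Qed.

(** Nested closed balls: if the operators were not uniformly bounded, every ball
    would contain a smaller one on which some [T n] exceeds a prescribed bound,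
    and the family would be unbounded at the common point of these balls. *)
Lemma uniform_boundedness (T : nat -> {linear V -> W}) :
  (forall n, continuous (T n)) ->
  (forall x, exists M : R, forall n, normR (T n x) <= M) ->
  exists M : R, forall n x, normR (T n x) <= M * normR x.
Proof.
move=> cT bT; apply: contrapT => nb.
have unb (M : R) : exists n x, M * normR x < normR (T n x).
  apply: contrapT => h; apply: nb; exists M => n x; rewrite leNgt; apply/negP => hx.
  by apply: h; exists n, x.
have step (k : nat) (p : V * R) : 0 < p.2 -> exists q : V * R,
    [/\ 0 < q.2, q.2 <= p.2 / 2, normR (q.1 - p.1) + q.2 <= p.2 &
        exists n, forall z, normR (z - q.1) <= q.2 -> k%:R <= normR (T n z)].
  case: p => x r /= r0.
  have [n [xi hxi]] := unb (4 * (k%:R + 1) / r).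
  have [C C0 hC] := continuous_linear_normR (cT n).
  have xi0 : 0 < normR xi.
    rewrite lt_def normR_ge0 andbT; apply/eqP => /normR0_eq0 xi0.
    by move: hxi; rewrite xi0 linear0 !normR0 mulr0 ltxx.
  pose a := r / 2 / normR xi; have a0 : 0 < a by rewrite !divr_gt0.
  pose z := a%:C *: xi.
  have nz : normR z = r / 2 by rewrite normRZr gtr0_norm// divfK// gt_eqF.
  have nTz : 2 * (k%:R + 1) < normR (T n z).
    rewrite linearZ /= normRZr gtr0_norm// -ltr_pdivrMl//.
    apply: le_lt_trans hxi; rewrite le_eqVlt; apply/orP; left; apply/eqP.
    by rewrite /a; field; rewrite !gt_eqF.
  (* T z is half the difference of the values at x + z and x - z, so one of these
     two points carries a large value. *)
  have [y [yx hy]] : exists y, normR (y - x) = r / 2 /\ k%:R + 1 <= normR (T n y).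
    have [h|h] := leP (k%:R + 1) (normR (T n (x + z))).
      by exists (x + z); rewrite addrC addKr.
    exists (x - z); rewrite addrC addKr normRN; split=> //.
    have : normR (T n z + T n z) <= normR (T n (x + z)) + normR (T n (x - z)).
      rewrite -(normRN (T n (x - z))); apply: le_trans (normRD _ _).
      have -> // : T n z + T n z = T n (x + z) - T n (x - z).
      rewrite -linearB -linearD; congr (T n _).
      by rewrite opprB [RHS]addrC addrA subrK.
    rewrite -mulr2n -scaler_nat -(rmorph_nat (real_complex R)) normRZr.
    have k0 : 0 <= k%:R :> R by [].
    by rewrite ger0_norm//; lra.
  exists (y, Num.min (r / 2) C^-1); split=> /=.
  - by rewrite lt_min divr_gt0// invr_gt0.
  - by rewrite ge_min lexx.
  - rewrite yx; have : Num.min (r / 2) C^-1 <= r / 2 by rewrite ge_min lexx.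
    lra.
  exists n => w hw; have : normR (T n (w - y)) <= 1.
    rewrite (le_trans (hC _))// -ler_pdivlMl// mulr1 (le_trans hw)//.
    by rewrite ge_min lexx orbT.
  rewrite linearB normRB => h.
  have := normRD (T n y - T n w) (T n w); rewrite subrK; lra.
have [f hf] : exists f : nat -> V * R -> V * R, forall k p, 0 < p.2 ->
    [/\ 0 < (f k p).2, (f k p).2 <= p.2 / 2,
        normR ((f k p).1 - p.1) + (f k p).2 <= p.2 &
        exists n, forall z, normR (z - (f k p).1) <= (f k p).2 ->
          k%:R <= normR (T n z)].
  have /choice [f hf] : forall kp : nat * (V * R), exists q : V * R, 0 < kp.2.2 ->
    [/\ 0 < q.2, q.2 <= kp.2.2 / 2, normR (q.1 - kp.2.1) + q.2 <= kp.2.2 &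
        exists n, forall z, normR (z - q.1) <= q.2 -> kp.1%:R <= normR (T n z)].
    move=> [k p]; have [p0|] := boolP (0 < p.2); last by exists p.
    by have [q hq] := step k p p0; exists q.
  by exists (fun k p => f (k, p)) => k p p0; have := hf (k, p) p0.
pose P := fix P n : V * R := if n is k.+1 then f k (P k) else (0, 1).
have P0 n : 0 < (P n).2 by elim: n => [|n IH] //=; have [] := hf n _ IH.
have Pdec n : (P n).2 <= 2^-1 ^+ n.
  elim: n => [|n IH] /=; first by rewrite expr0.
  have [_ h _ _] := hf n _ (P0 n).
  by rewrite (le_trans h)// exprSr ler_pM2r// invr_gt0.
have Pnest n k : normR ((P (n + k)%N).1 - (P n).1) + (P (n + k)%N).2 <= (P n).2.
  elim: k => [|k IH]; first by rewrite addn0 subrr normR0 add0r.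
  rewrite addnS /=; have [_ _ h _] := hf (n + k)%N _ (P0 (n + k)%N).
  have := normR_triangle (f (n + k)%N (P (n + k)%N)).1 (P (n + k)%N).1 (P n).1.
  lra.
have Pclose n m : (n <= m)%N -> normR ((P m).1 - (P n).1) <= (P n).2.
  move=> /subnKC <-; have := Pnest n (m - n)%N; have := P0 (n + (m - n))%N; lra.
have [x Px] : exists x : V, (P n).1 @[n --> \oo] --> x.
  apply: complete_normR => e e0.
  have e4 : 0 < e / 4 by rewrite divr_gt0.
  have [N _ hN] : \forall n \near \oo, (2^-1 : R) ^+ n < e / 4.
    have : (2^-1 : R) ^+ n @[n --> \oo] --> (0 : R).
      by apply: cvg_expr; rewrite ger0_norm ?invr_ge0// invf_lt1// ltr1n.
    move=> /cvgr_lt; exact.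
  exists N => m n Nm Nn.
  have := normR_triangle (P m).1 (P N).1 (P n).1.
  have := Pclose _ _ Nm; have := Pclose _ _ Nn; rewrite (normRB (P n).1).
  have := Pdec N; have := hN N (leqnn N); rewrite /=; lra.
have xP n : normR (x - (P n).1) <= (P n).2.
  apply/ler_addgt0Pr => e e0.
  have [N _ hN] := (cvg_normRP _ _ _).1 Px e e0.
  have := hN (maxn N n) (leq_maxl _ _); rewrite /= normRB => h.
  have := normR_triangle x (P (maxn N n)).1 (P n).1.
  have := Pclose n (maxn N n) (leq_maxr _ _); lra.
have [M hM] := bT x.
have [_ _ _ [n]] := hf (Num.bound `|M|) _ (P0 (Num.bound `|M|)).
move/(_ x (xP (Num.bound `|M|).+1)).
apply/negP; rewrite -ltNge (le_lt_trans (hM n))//.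
by rewrite (le_lt_trans (ler_norm _))// archi_boundP.
Qed.

End UniformBoundedness.

(** * Derivatives and primitives of real functions *)

Section Calculus.
Variable R : realType.
Implicit Types (f g : R -> R) (a b t : R).

Lemma is_derive_small_o f t (d : R) :
  (forall e, 0 < e -> exists2 r : R, 0 < r & forall h, `|h| < r ->
    `|f (t + h) - f t - h * d| <= e * `|h|) ->
  is_derive t 1 f d.
Proof.
move=> hf.
have cv : h^-1 *: ((f \o shift t) (h *: 1) - f t) @[h --> 0^'] --> d.
  apply/cvgrPdist_le => e e0; have [r r0 hr] := hf e e0.
  near=> h.
  have h0 : h != 0 by near: h; exact: nbhs_dnbhs_neq.
  have hh : `|h| < r.
    by near: h; apply: dnbhs0_lt.
  have := hr h hh; rewrite /= [h *: 1]mulr1 (addrC h t) => H.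
  rewrite distrC /GRing.scale /=.
  rewrite (_ : _ - d = h^-1 * (f (t + h) - f t - h * d)); last by field.
  by rewrite normrM normfV ler_pdivrMl ?normr_gt0// [_ * e]mulrC.
split; last exact: cvg_lim cv.
by apply/cvg_ex; exists d; exact: cv.
Unshelve. all: by end_near. Qed.

(** The lower endpoint -1 keeps 0 interior to the interval of differentiability. *)
Definition prim f t : R := (\int[lebesgue_measure]_(s in `[(-1)%R, t]) f s)%R.

Lemma continuous_integrable_itv f a b : continuous f ->
  lebesgue_measure.-integrable `[a, b] (EFin \o f).
Proof.
move=> cf; apply: continuous_compact_integrable; first exact: segment_compact.
exact: continuous_subspaceT.
Qed.

Lemma is_derive_prim f t : continuous f -> -1 < t -> is_derive t 1 (prim f) (f t).
Proof.
move=> cf t1.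
have tt : t < t + 1 by rewrite ltrDl.
have [|||df <-] := @continuous_FTC1_closed R f (-1) t (t + 1) tt.
- exact: continuous_integrable_itv.
- exact: t1.
- exact: cf.
by rewrite derive1E; exact/derivableP.
Qed.

Lemma prim_continuous f a b : continuous f -> -1 < a ->
  {within `[a, b], continuous (prim f)}.
Proof.
move=> cf a1; apply: derivable_within_continuous => t; rewrite in_itv/= => /andP[at' _].
by have [] := is_derive_prim cf (lt_le_trans a1 at').
Qed.

Lemma integral_prim f (T : R) : continuous f -> 0 < T ->
  (\int[lebesgue_measure]_(s in `[0%R, T]) (f s)%:E
     = (prim f T - prim f 0)%:E)%E.
Proof.
move=> cf T0; rewrite EFinB; apply: continuous_FTC2 => //.
- exact: continuous_subspaceT.
- have c0 : {within `[0, T], continuous (prim f)} by apply: prim_continuous => //; lra.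
  have [|? ? ?] := (continuous_within_itvP (prim f) T0).1 => //.
  split=> // t; rewrite in_itv/= => /andP[t0 _].
  by have [] := @is_derive_prim f t cf (lt_trans (ltrN10 R) t0).
- move=> t; rewrite in_itv/= => /andP[t0 _]; rewrite derive1E.
  have t1 : -1 < t by apply: lt_trans t0; lra.
  by have := is_derive_prim cf t1; case.
Qed.

End Calculus.

(** * Orbits of strongly continuous semigroups *)

Section Curves.
Variables (R : realType) (V : normedModType R[i]) (H : hilbertType R).

Lemma cvg_normR (T : Type) (F : set_system T) (FF : Filter F) (f : T -> V) l :
  f @ F --> l -> normR (f t) @[t --> F] --> normR l.
Proof.
move=> /cvg_normRP fl; apply/cvgrPdist_lt => e e0.
apply: filterS (fl _ e0) => t; apply: le_lt_trans.
rewrite ler_norml; have := normRD (f t - l) l; have := normRD (l - f t) (f t).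
by rewrite !subrK (normRB l) => h1 h2; apply/andP; split; lra.
Qed.

Lemma cvg_rinl (T : Type) (F : set_system T) (FF : Filter F) (f : T -> H) l y :
  f @ F --> l -> rin (f t) y @[t --> F] --> rin l y.
Proof.
move=> /cvg_normRP fl; apply/cvgrPdist_le => e e0.
have y0 : 0 < normR y + 1 by rewrite ltr_wpDl ?normR_ge0.
apply: filterS (fl _ (divr_gt0 e0 y0)) => t ht.
rewrite distrC -rinBl (le_trans (rin_norm_le _ _))//.
rewrite (le_trans (ler_wpM2r (normR_ge0 y) (ltW ht)))//.
by rewrite mulrAC ler_pdivrMr// ler_wpM2l ?(ltW e0)// lerDl.
Qed.

Lemma at_right0P (P : R -> Prop) : (\forall h \near 0^'+, P h) <->
  exists2 r : R, 0 < r & forall h, 0 < h < r -> P h.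
Proof.
split=> [[r r0 hr]|[r r0 hr]].
  exists r => // h /andP[h0 hr']; apply: hr => //=.
  by rewrite sub0r normrN gtr0_norm.
exists r => // h /=; rewrite sub0r normrN => hr' h0; apply: hr.
by rewrite h0 (le_lt_trans (ler_norm h)).
Qed.

End Curves.

Section Semigroup.
Variables (R : realType) (H : hilbertType R) (S : R -> {linear H -> H}).
Hypothesis C0S : C0_semigroup S.

Let S_cont t : 0 <= t -> continuous (S t). Proof. by case: C0S => h _ _ _; exact: h. Qed.
Let S0 x : S 0 x = x. Proof. by case: C0S. Qed.
Let SD s t x : 0 <= s -> 0 <= t -> S (s + t) x = S s (S t x).
Proof. by case: C0S => _ _ h _; exact: h. Qed.

Lemma semigroup_at0 x (e : R) : 0 < e ->
  exists2 r : R, 0 < r & forall h, 0 <= h < r -> normR (S h x - x) < e.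
Proof.
move=> e0; have [_ _ _ /(_ x) /cvg_normRP /(_ _ e0) /at_right0P[r r0 hr]] := C0S.
exists r => // h /andP[]; rewrite le_eqVlt => /predU1P[<- _|h0 h1].
  by rewrite S0 subrr normR0.
by apply: hr; rewrite h0.
Qed.

(** Otherwise there are times t_n tending to 0 with unbounded operators S(t_n),
    although S(t_n) x converges to x for every x. *)
Lemma semigroup_bounded_near0 : exists2 d : R, 0 < d &
  exists2 M : R, 0 < M & forall t x, 0 <= t <= d -> normR (S t x) <= M * normR x.
Proof.
apply: contrapT => nb.
have /choice [t ht] : forall n : nat, exists t, 0 <= t <= n.+1%:R^-1 /\
    exists x, n.+1%:R * normR x < normR (S t x).
  move=> n; apply: contrapT => h; apply: nb.
  exists n.+1%:R^-1; first by rewrite invr_gt0 ltr0n.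
  exists n.+1%:R; first by rewrite ltr0n.
  move=> t x ht; rewrite leNgt; apply/negP => hx; apply: h; exists t; split=> //.
  by exists x.
have [n|x|M hM] := @uniform_boundedness R H H (fun n => S (t n)).
- by apply: S_cont; have [/andP[]] := ht n.
- have [r r0 hr] := semigroup_at0 x ltr01.
  have [N hN] := inv_succ_lt r0.
  exists (\sum_(k < N) normR (S (t k) x) + (normR x + 1)) => n.
  have [nN|Nn] := ltnP n N.
    rewrite (bigD1 (Ordinal nN)) //= -addrA lerDl addr_ge0//.
      by rewrite sumr_ge0// => k _; exact: normR_ge0.
    by rewrite addr_ge0 ?normR_ge0.
  rewrite (@le_trans _ _ (normR x + 1))//; last first.
    by rewrite lerDr sumr_ge0// => k _; exact: normR_ge0.
  have [/andP[t0 tn] _] := ht n.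
  have /hr : 0 <= t n < r.
    by rewrite t0 (le_lt_trans tn)// hN.
  by have := normRD (S (t n) x - x) x; rewrite subrK; lra.
have [_ [x]] := ht (Num.bound `|M|); apply/negP; rewrite -leNgt.
rewrite (le_trans (hM _ x))// ler_wpM2r ?normR_ge0// (le_trans (ler_norm _))//.
by rewrite (le_trans (ltW (archi_boundP _)))// ler_nat.
Qed.

(** Doubling the length of the interval squares the bound. *)
Lemma semigroup_locally_bounded (T : R) : exists2 M : R, 0 < M &
  forall t x, 0 <= t <= T -> normR (S t x) <= M * normR x.
Proof.
have [d d0 [M M0 hM]] := semigroup_bounded_near0.
suff doubling n : exists2 M : R, 0 < M &
    forall t x, 0 <= t <= d * 2 ^+ n -> normR (S t x) <= M * normR x.
  have [K K0 hK] := doubling (Num.bound `|T / d|).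
  exists K => // t x /andP[t0 tT]; apply: hK; rewrite t0 (le_trans tT)//.
  rewrite -ler_pdivrMl// mulrC (le_trans (ler_norm _))//.
  rewrite (le_trans (ltW (archi_boundP _)))// -natrX ler_nat.
  exact/ltnW/ltn_expl.
elim: n => [|n [K K0 hK]]; first by exists M => // t x; rewrite expr0 mulr1; exact: hM.
exists (K * K) => [|t x /andP[t0 tn]]; first exact: mulr_gt0.
have t2 : 0 <= t / 2 <= d * 2 ^+ n.
  by rewrite divr_ge0//= ler_pdivrMr// -mulrA -exprSr.
have /andP[t20 _] := t2.
by rewrite [t]splitr SD// -mulrA (le_trans (hK _ _ t2))// ler_pM2l// hK.
Qed.

Lemma semigroup_modulus x (T e : R) : 0 < e ->
  exists2 r : R, 0 < r & forall a b, 0 <= a <= T -> 0 <= b <= T -> `|a - b| < r ->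
    normR (S a x - S b x) <= e.
Proof.
move=> e0; have [M M0 hM] := semigroup_locally_bounded T.
have [r r0 hr] := semigroup_at0 x (divr_gt0 e0 M0).
exists r => // a b; wlog ab : a b / a <= b.
  move=> h aT bT; have [ab|/ltW ba] := leP a b; first exact: h.
  by rewrite distrC normRB; exact: h.
move=> aT /andP[b0 bT]; rewrite distrC ger0_norm ?subr_ge0// => abr.
have /andP[a0 _] := aT.
have -> : S b x = S a (S (b - a) x) by rewrite -SD ?subr_ge0// addrC subrK.
rewrite -linearB (le_trans (hM _ _ aT))// -ler_pdivlMl// mulrC normRB ltW// hr//.
by rewrite subr_ge0 ab.
Qed.

(** The orbit of x, frozen at x for negative times so as to be continuous on R. *)
Definition orbit x (t : R) : H := S (Num.max t 0) x.

Lemma orbit_ge0 x t : 0 <= t -> orbit x t = S t x.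
Proof. by move=> t0; rewrite /orbit max_l. Qed.

Lemma orbit_continuous x : continuous (orbit x).
Proof.
move=> t; apply/cvg_normRP => e e0.
have e2 : 0 < e / 2 by rewrite divr_gt0.
have [r r0 hr] := semigroup_modulus x (Num.max t 0 + 1) e2.
have maxB (a b : R) : `|Num.max a 0 - Num.max b 0| <= `|a - b| :> R.
  have := ler_norm (b - a); rewrite distrC; have := ler_norm (a - b).
  have [ha|/ltW ha] := leP 0 a; have [hb|/ltW hb] := leP 0 b;
    rewrite ?(max_l ha) ?(max_r ha) ?(max_l hb) ?(max_r hb) => h1 h2;
    by rewrite ler_norml; apply/andP; split; lra.
have : \forall s \near t, `|s - t| < Num.min r 1.
  have /cvgrPdist_lt : (id : R -> R) @ t --> t by exact: cvg_id.
  move=> /(_ (Num.min r 1)); rewrite lt_min r0 ltr01 => /(_ isT).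
  by apply: filterS => s; rewrite distrC.
apply: filterS => s; rewrite lt_min => /andP[sr s1].
apply: le_lt_trans (_ : e / 2 < e); last lra.
apply: hr; last exact: le_lt_trans (maxB _ _) sr.
- rewrite le_max lexx orbT /=.
  have := maxB s t; have := ler_norm (Num.max s 0 - Num.max t 0); lra.
- by rewrite le_max lexx orbT /= lerDl.
Qed.

Lemma diff_quotient_norm (h : R) (z y : H) : 0 < h ->
  h * normR ((h^-1)%:C *: z - y) = normR (z - h%:C *: y).
Proof.
move=> h0; rewrite -[in LHS](gtr0_norm h0) -normRZr scalerBr scalerA.
by rewrite -rmorphM gtr0_norm// divff ?gt_eqF// rmorph1 scale1r.
Qed.

Section Generator.
Variable L : operator H H.
Hypothesis genL : generates L S.

Lemma generator_small x : dom L x -> forall e : R, 0 < e ->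
  exists2 r : R, 0 < r & forall h, 0 <= h < r ->
    normR (S h x - x - h%:C *: L x) <= e * h.
Proof.
move=> Lx e e0; have /genL/cvg_normRP/(_ _ e0)/at_right0P[r r0 hr] := conj Lx (erefl (L x)).
exists r => // h /andP[]; rewrite le_eqVlt => /predU1P[<- _|h0 h1].
  by rewrite S0 subrr scale0r subr0 normR0 mulr0.
have /hr/ltW : 0 < h < r by rewrite h0.
by rewrite -(ler_pM2l h0) diff_quotient_norm// [h * e]mulrC.
Qed.

Lemma generator_intro x y :
  (forall e : R, 0 < e -> exists2 r : R, 0 < r & forall h, 0 < h < r ->
    normR (S h x - x - h%:C *: y) <= e * h) -> dom L x /\ L x = y.
Proof.
move=> hxy; apply/genL/cvg_normRP => e e0; apply/at_right0P.
have e2 : 0 < e / 2 by rewrite divr_gt0.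
have [r r0 hr] := hxy _ e2; exists r => // h hh.
have /andP[h0 _] := hh; apply: le_lt_trans (_ : e / 2 < e); last lra.
by rewrite -(ler_pM2l h0) diff_quotient_norm// [h * (e / 2)]mulrC hr.
Qed.

Lemma generatorB x y : dom L x -> dom L y -> dom L (x - y) /\ L (x - y) = L x - L y.
Proof.
move=> Lx Ly; apply: generator_intro => e e0.
have e2 : 0 < e / 2 by rewrite divr_gt0.
have [r r0 hr] := generator_small Lx e2; have [s s0 hs] := generator_small Ly e2.
exists (Num.min r s) => [|h /andP[h0]]; first by rewrite lt_min r0.
rewrite lt_min => /andP[/(conj (ltW h0))/andP/hr hx /(conj (ltW h0))/andP/hs hy].
rewrite linearB scalerBr.
have sBB (a b c d : H) : a - b - (c - d) = a - c - (b - d).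
  by rewrite !opprB addrACA [RHS]addrACA [- b - c]addrC.
rewrite (_ : _ - _ = (S h x - x - h%:C *: L x) - (S h y - y - h%:C *: L y)).
  have := normRD (S h x - x - h%:C *: L x) (- (S h y - y - h%:C *: L y)).
  rewrite normRN; lra.
by rewrite (sBB (S h x)) (sBB (S h x - x)).
Qed.

Let stepE (T : {linear H -> H}) (h : R) (x y z : H) :
  T (x - y - h%:C *: z) = T x - T y - h%:C *: T z.
Proof. by rewrite linearB [T (x - y)]linearB [T (_ *: _)]linearZ. Qed.

Lemma generator_orbit x t : dom L x -> 0 <= t ->
  dom L (S t x) /\ L (S t x) = S t (L x).
Proof.
move=> Lx t0; apply: generator_intro => e e0.
have [C C0 hC] := continuous_linear_normR (S_cont t0).
have [r r0 hr] := generator_small Lx (divr_gt0 e0 C0).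
exists r => // h /andP[h0 hh].
have -> : S h (S t x) - S t x - h%:C *: S t (L x) = S t (S h x - x - h%:C *: L x).
  by rewrite stepE -!SD ?(ltW h0)// [h + t]addrC.
rewrite (le_trans (hC _))// -ler_pdivlMl// mulrA [C^-1 * e]mulrC hr//.
by rewrite ltW.
Qed.

(** Two-sided differentiability, although the generator is a right derivative:
    local boundedness transports the right increment at an earlier time. *)
Lemma is_derive_orbit x (t : R) y : dom L x -> 0 < t ->
  is_derive t 1 (fun s => rin (orbit x s) y) (rin (orbit (L x) t) y).
Proof.
move=> Lx t0; apply: is_derive_small_o => e e0.
have [M M0 hM] := semigroup_locally_bounded t.
pose K := 2 * M * (normR y + 1).
have K0 : 0 < K by rewrite !mulr_gt0// ltr_wpDl ?normR_ge0.
have eK : 0 < e / K by rewrite divr_gt0.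
have [r r0 hr] := generator_small Lx eK.
have [s s0 hs] := semigroup_at0 (L x) eK.
exists (Num.min (Num.min r s) t) => [|h]; first by rewrite !lt_min r0 s0.
rewrite !lt_min => /andP[/andP[hhr hhs] hht].
suff est : normR (S (t + h) x - S t x - h%:C *: S t (L x)) <= 2 * M * (e / K * `|h|).
  have th : 0 <= t + h by move: hht; rewrite ltr_norml; lra.
  rewrite !orbit_ge0 ?(ltW t0)// -rinBl -rinZl -rinBl.
  rewrite (le_trans (rin_norm_le _ _))// (le_trans (ler_wpM2r (normR_ge0 y) est))//.
  have -> : 2 * M * (e / K * `|h|) * normR y = (e * `|h|) * (2 * M * normR y / K).
    by ring.
  rewrite ler_piMr ?mulr_ge0 ?(ltW e0)// ler_pdivrMr// mul1r /K.
  by rewrite ler_pM2l ?mulr_gt0// lerDl.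
have tt : 0 <= t <= t by rewrite (ltW t0) lexx.
have [h0|h0] := leP 0 h.
  have -> : S (t + h) x - S t x - h%:C *: S t (L x) = S t (S h x - x - h%:C *: L x).
    by rewrite stepE -!SD ?(ltW t0).
  rewrite (le_trans (hM _ _ tt))// -mulrA mulrCA ler_pM2l// ger0_norm//.
  have := hr h; rewrite h0 -(ger0_norm h0) hhr ger0_norm// => /(_ isT).
  have : 0 <= e / K * h by rewrite mulr_ge0 ?(ltW eK).
  lra.
(* A left increment is a right increment at the earlier time t + h. *)
have [k hk] : exists k, h = - k by exists (- h); rewrite opprK.
rewrite {h}hk oppr_lt0 normrN rmorphN scaleNr opprK in h0 hhr hhs hht *.
rename h0 into k0; rewrite gtr0_norm// in hhr hhs hht *.
have tk : 0 <= t - k <= t by rewrite subr_ge0 (ltW hht) gerBl ltW.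
have /andP[tk0 _] := tk.
have St z : S t z = S (t - k) (S k z) by rewrite -SD ?subrK// ltW.
have -> : S (t - k) x - S t x + k%:C *: S t (L x) =
    S (t - k) (k%:C *: (S k (L x) - L x) - (S k x - x - k%:C *: L x)).
  rewrite !St -linearB -linearZ -linearD; congr (S (t - k) _).
  by rewrite scalerBr !opprB [RHS]addrA subrK addrC.
rewrite (le_trans (hM _ _ tk))// -mulrA mulrCA ler_pM2l//.
rewrite (le_trans (normRD _ _))// normRN normRZr gtr0_norm//.
have /hr h1 : 0 <= k < r by rewrite (ltW k0).
have /hs/ltW h2 : 0 <= k < s by rewrite (ltW k0).
have h3 : k * normR (S k (L x) - L x) <= e / K * k by rewrite mulrC ler_pM2r.
lra.
Qed.

End Generator.

End Semigroup.

(** * Density of the domain of a generator *)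

Section Prim.
Variable R : realType.
Implicit Types f g : R -> R.

Lemma primD f g t : continuous f -> continuous g ->
  prim (fun s => f s + g s) t = prim f t + prim g t.
Proof.
move=> cf cg; rewrite /prim RintegralD//;
  exact: continuous_integrable_itv.
Qed.

Lemma primZ (a : R) f t : continuous f -> prim (fun s => a * f s) t = a * prim f t.
Proof. by move=> cf; rewrite /prim RintegralZl//; exact: continuous_integrable_itv. Qed.

Lemma prim_increment f (a b : R) : continuous f -> -1 < a -> a < b ->
  exists2 c, a <= c <= b & prim f b - prim f a = f c * (b - a).
Proof.
move=> cf a1 ab.
have df t : t \in `]a, b[ -> is_derive t 1 (prim f) (f t).
  rewrite in_itv/= => /andP[at' _].
  exact/is_derive_prim/(lt_trans a1).
have [c cab fc] := MVT ab df (prim_continuous (b := b) cf a1).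
by exists c => //; move: cab; rewrite in_itv/= => /andP[/ltW -> /ltW ->].
Qed.

Lemma prim_shift f g (t h : R) : continuous f -> continuous g -> 0 <= t -> 0 < h ->
  (forall s, 0 < s < h -> g s = f (s + t)) ->
  prim g h - prim g 0 = prim f (h + t) - prim f t.
Proof.
move=> cf cg t0 h0 gf.
pose E (s : R) := prim g s - prim f (s + t).
have dE (s : R) : -1 < s -> is_derive s 1 E (g s - f (s + t)).
  move=> s1; apply: is_deriveB; first exact: is_derive_prim.
  have df : is_derive (s + t) 1 (prim f) (f (s + t)).
    by apply: is_derive_prim => //; lra.
  have ds : is_derive s (1 : R) (shift t) 1 by exact: is_derive_shift.
  by have := @is_derive1_comp R (prim f) (shift t) s _ _ df ds; rewrite mulr1.
have cE : {within `[0, h], continuous E}.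
  apply: derivable_within_continuous => s; rewrite in_itv/= => /andP[s0 _].
  by have [] := dE s (lt_le_trans (ltrN10 R) s0).
have dE' (s : R) : s \in `]0, h[ -> is_derive s 1 E (g s - f (s + t)).
  by rewrite in_itv/= => /andP[s0 _]; apply: dE; lra.
have [c] := MVT h0 dE' cE.
by rewrite in_itv/= => /gf ->; rewrite /E subrr mul0r add0r; lra.
Qed.

End Prim.

Section Density.
Variables (R : realType) (H : hilbertType R) (S : R -> {linear H -> H}).
Hypothesis C0S : C0_semigroup S.
Variable L : operator H H.
Hypothesis genL : generates L S.

Let orb x y : R -> R := fun s => rin (orbit S x s) y.

Let orb_continuous x y : continuous (orb x y).
Proof. by move=> t; apply: cvg_rinl; exact: orbit_continuous. Qed.

(** The integral of the orbit over [0, h], obtained from the scalar integrals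
    of its coordinates by the representation theorem. *)
Lemma orbit_integral x (h : R) : 0 < h ->
  exists v, forall y, rin v y = prim (orb x y) h - prim (orb x y) 0.
Proof.
move=> h0; have [M M0 hM] := semigroup_locally_bounded C0S h.
have [|||v hv] := @riesz R H (fun y => prim (orb x y) h - prim (orb x y) 0)
  (M * normR x * h).
- move=> y z; have -> : orb x (y + z) = fun s => orb x y s + orb x z s.
    by apply/funext => s; rewrite /orb rinDr.
  by rewrite !primD; [ring|exact: orb_continuous..].
- move=> a y; have -> : orb x (a%:C *: y) = fun s => a * orb x y s.
    by apply/funext => s; rewrite /orb rinZr.
  by rewrite !primZ; [ring|exact: orb_continuous..].
- move=> y; have [c /andP[c0 ch] ->] :=
    prim_increment (orb_continuous (x := x) (y := y)) (ltrN10 R) h0.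
  rewrite subr0 normrM (gtr0_norm h0) mulrAC ler_pM2r//.
  rewrite (le_trans (rin_norm_le _ _))// ler_wpM2r ?normR_ge0// orbit_ge0//.
  by apply: hM; rewrite c0.
- by exists v => y; rewrite rinC -hv.
Qed.

Lemma generatorZ (a : R[i]) x : dom L x -> dom L (a *: x) /\ L (a *: x) = a *: L x.
Proof.
move=> Lx; apply: (generator_intro genL) => e e0.
pose na := complex.Re `|a|.
have na0 : 0 <= na by rewrite /na normc_def sqrtr_ge0.
have a1 : 0 < na + 1 by rewrite ltr_wpDl.
have [r r0 hr] := generator_small C0S genL Lx (divr_gt0 e0 a1).
exists r => // h /andP[h0 hhr].
have -> : S h (a *: x) - a *: x - h%:C *: (a *: L x) =
    a *: (S h x - x - h%:C *: L x).
  by rewrite [S h (_ *: _)]linearZ /= !scalerBr !scalerA [h%:C * _]mulrC.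
rewrite normRZ -/na (le_trans (ler_wpM2l na0 (hr h _)))// ?(ltW h0)//.
rewrite mulrA ler_pM2r// mulrCA ler_piMr ?(ltW e0)//.
by rewrite ler_pdivrMr// mul1r lerDl.
Qed.

(** S(t) moves the interval of integration, so that S(t) v - v is the integral of
    the orbit over [h, h + t] minus the one over [0, t]; both are t times a value
    of the orbit up to o(t), uniformly in the test vector. *)
Lemma orbit_integral_dom x v (h : R) : 0 < h ->
  (forall y, rin v y = prim (orb x y) h - prim (orb x y) 0) -> dom L v.
Proof.
move=> h0 hv; suff [] : dom L v /\ L v = S h x - x by [].
apply: (generator_intro genL) => e e0.
have e2 : 0 < e / 2 by rewrite divr_gt0.
have [r r0 hr] := semigroup_modulus C0S x (h + 1) e2.
exists (Num.min r 1) => [|t /andP[t0]]; first by rewrite lt_min r0 ltr01.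
rewrite lt_min => /andP[tr t1].
apply: normR_dual_le => [|y]; first by rewrite mulr_ge0 ?ltW.
have [C C0 hC] : exists2 C : R, 0 < C & forall u, normR (S t u) <= C * normR u.
  by apply: continuous_linear_normR; case: C0S => + _ _ _; apply; exact: ltW.
have [|||ys hys] := @riesz R H (fun u => rin (S t u) y) (C * normR y).
- by move=> a b; rewrite linearD rinDl.
- by move=> a b; rewrite linearZ rinZl.
- move=> u; rewrite (le_trans (rin_norm_le _ _))// mulrAC ler_wpM2r ?normR_ge0//.
have Stv : rin (S t v) y = prim (orb x y) (h + t) - prim (orb x y) t.
  rewrite hys hv; apply: prim_shift => //; try exact: orb_continuous.
    exact: ltW.
  move=> s /andP[s0 _]; rewrite /orb -hys !orbit_ge0 ?ltW ?addr_gt0//.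
  by case: C0S => _ _ SD _; rewrite -SD ?ltW// addrC.
rewrite !rinBl rinZl rinBl Stv hv.
have t_1 : -1 < h by lra.
have [c /andP[c0 ct] Ec] :=
  prim_increment (orb_continuous (x := x) (y := y)) (ltrN10 R) t0.
have hht : h < h + t by rewrite ltrDl.
have [d /andP[d0 dt] Ed] :=
  prim_increment (orb_continuous (x := x) (y := y)) t_1 hht.
have hc : rin (S 0 x - S c x) y <= e / 2 * normR y.
  rewrite (le_trans (rin_le _ _))// ler_wpM2r ?normR_ge0// hr//.
  - by rewrite lexx addr_ge0 ?ltW.
  - by rewrite c0; lra.
  - by rewrite sub0r normrN ger0_norm//; lra.
have hd : rin (S d x - S h x) y <= e / 2 * normR y.
  rewrite (le_trans (rin_le _ _))// ler_wpM2r ?normR_ge0// hr//.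
  - by apply/andP; split; lra.
  - by apply/andP; split; lra.
  - by rewrite ger0_norm; lra.
rewrite (_ : _ - _ - _ - _ = t * rin (S 0 x - S c x) y + t * rin (S d x - S h x) y).
  have := ler_wpM2l (ltW t0) hc; have := ler_wpM2l (ltW t0) hd; lra.
have S0 : S 0 x = x by case: C0S.
have E1 : prim (orb x y) t - prim (orb x y) 0 = rin (S c x) y * t.
  by rewrite Ec subr0 /orb orbit_ge0.
have E2 : prim (orb x y) (h + t) - prim (orb x y) h = rin (S d x) y * t.
  by rewrite Ed /orb orbit_ge0; [congr (_ * _); ring | lra].
rewrite !rinBl S0; lra.
Qed.

(** The averages of the orbit of x over [0, h] tend to x. *)
Lemma dense_generator x (e : R) : 0 < e ->
  exists2 z, dom L z & normR (z - x) <= e.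
Proof.
move=> e0; have [r r0 hr] := semigroup_at0 C0S x e0.
pose h := r / 2; have h0 : 0 < h by rewrite divr_gt0.
have hhr : h < r by rewrite /h; lra.
have [v hv] := orbit_integral x h0.
exists ((h^-1)%:C *: v); first exact: (generatorZ _ (orbit_integral_dom h0 hv)).1.
rewrite -(ler_pM2l h0) diff_quotient_norm//.
apply: normR_dual_le => [|y]; first by rewrite mulr_ge0 ?ltW.
have [c /andP[c0 ch] Ec] :=
  prim_increment (orb_continuous (x := x) (y := y)) (ltrN10 R) h0.
rewrite rinBl rinZl hv Ec /orb orbit_ge0// subr0 [_ * h]mulrC -mulrBr -rinBl.
rewrite -[h * e * _]mulrA ler_pM2l//.
rewrite (le_trans (rin_le _ _))// ler_wpM2r ?normR_ge0// ltW// hr// c0.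
exact: le_lt_trans hhr.
Qed.

End Density.

(** * Duality with the extrapolation space *)

Lemma normR_Complex (R : realType) (a b : R) :
  normR (Complex a b : (R[i])^o) <= `|a| + `|b|.
Proof.
rewrite /normR normc_def /= -(ler_pXn2r (n := 2)) ?nnegrE ?sqrtr_ge0 ?addr_ge0//.
rewrite sqr_sqrtr ?addr_ge0 ?sqr_ge0// sqrrD !real_normK ?num_real//.
by rewrite -addrA lerD2l lerDr mulrn_wge0// mulr_ge0.
Qed.

Section InnerC.
Variables (R : realType) (H : hilbertType R).

Lemma innerBl (x y z : H) : inner (x - y) z = inner x z - inner y z.
Proof. exact: linearBl. Qed.

Lemma innerDl (x y z : H) : inner (x + y) z = inner x z + inner y z.
Proof. exact: linearDl. Qed.

Lemma innerZl (a : R[i]) (x z : H) : inner (a *: x) z = a * inner x z.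
Proof. exact: linearZl_LR. Qed.

Lemma innerBr (x y z : H) : inner z (x - y) = inner z x - inner z y.
Proof. exact: linearBr. Qed.

Lemma innerZr (a : R[i]) (x z : H) : inner z (a *: x) = a^*%C * inner z x.
Proof. exact: linearZr_LR. Qed.

Lemma adjointP (L : operator H H) (y : H) : dom (adjoint L) y ->
  forall x, dom L x -> inner (L x) y = inner x (adjoint L y).
Proof. by move=> Ly; exact: (xgetPex (0 : H) Ly). Qed.

Lemma cvg_inner (T : Type) (F : set_system T) (FF : Filter F) (f : T -> H) l y :
  f @ F --> l -> (inner (f t) y : (R[i])^o) @[t --> F] --> (inner l y : (R[i])^o).
Proof.
move=> fl; apply/(@cvg_normRP R (R[i])^o) => e e0.
have e2 : 0 < e / 2 by rewrite divr_gt0.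
move/cvgrPdist_lt : (cvg_rinl (y := y) FF fl) => /(_ _ e2).
move/cvgrPdist_lt : (cvg_rinl (y := 'i%C *: y) FF fl) => /(_ _ e2).
apply: filterS2 => t; rewrite -!rinBl => h1 h2.
rewrite (normRB (inner (f t) y : (R[i])^o)) -innerBl innerE.
rewrite (le_lt_trans (normR_Complex _ _))//.
by rewrite [e]splitr; exact: ltrD.
Qed.

End InnerC.

Section Duality.
Variables (R : realType) (H U : hilbertType R).
Variables (Hm1 : completeNormedModType R[i]) (j : {linear H -> Hm1}).
Variables (A : operator H H) (S : R -> {linear H -> H}).
Variables (rho0 : R) (B : {linear U -> Hm1}).
Hypotheses (C0S : C0_semigroup S) (genA : generates A S).
Hypothesis resA : resolvent_set A rho0%:C.
Hypothesis ext : extrapolation_space j A rho0.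
Hypothesis contB : continuous B.

Let Rs f := resolvent A rho0%:C f.

Let RsP f : dom A (Rs f) /\ rho0%:C *: Rs f - A (Rs f) = f.
Proof.
case: resA => -[_ _ /(_ f I)[x Ax hx]] _.
by have := @xgetI _ 0 [set x | dom A x /\ rho0%:C *: x - A x = f] x (conj Ax hx).
Qed.

Let Rs_inj x : dom A x -> Rs (rho0%:C *: x - A x) = x.
Proof.
case: resA => -[_ inj _] _ Ax.
by have [d e] := RsP (rho0%:C *: x - A x); apply: inj => //; rewrite inE.
Qed.

Let RsB f g : Rs (f - g) = Rs f - Rs g.
Proof.
have [df ef] := RsP f; have [dg eg] := RsP g.
have [dfg efg] := generatorB C0S genA df dg.
rewrite -(Rs_inj dfg) efg; congr Rs.
rewrite -[in LHS]ef -[in LHS]eg scalerBr !opprB addrACA [RHS]addrACA.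
by rewrite [- _ + - _]addrC.
Qed.

Let RsD f g : Rs (f + g) = Rs f + Rs g.
Proof.
by rewrite -[in RHS](addrK g f) RsB subrK.
Qed.

Let j_norm f : normR (j f) = normR (Rs f). Proof. by case: ext. Qed.

(** [lifts e r] says that r is the image of e under the extension of the
    resolvent to an isometry from the extrapolation space onto H. *)
Definition lifts (e : Hm1) (r : H) := forall d : R, 0 < d ->
  exists f, normR (j f - e) < d /\ normR (Rs f - r) < d.

Lemma lifts_of_cauchy (u : nat -> H) (e : Hm1) (r : H) :
  j (u n) @[n --> \oo] --> e -> Rs (u n) @[n --> \oo] --> r -> lifts e r.
Proof.
move=> /cvg_normRP ue /cvg_normRP ur d d0.
have [n [h1 h2]] := filter_ex (filterI (ue d d0) (ur d d0)).
by exists (u n).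
Qed.

Lemma lifts_cvg (u : nat -> H) (e : Hm1) (r : H) : lifts e r ->
  j (u n) @[n --> \oo] --> e -> Rs (u n) @[n --> \oo] --> r.
Proof.
move=> er /cvg_normRP ue; apply/cvg_normRP => d d0.
have d3 : 0 < d / 3 by rewrite divr_gt0.
have [f [h1 h2]] := er _ d3; apply: filterS (ue _ d3) => n hn.
have := normR_triangle (Rs (u n)) (Rs f) r.
rewrite -RsB -j_norm linearB.
have := normR_triangle (j (u n)) e (j f); rewrite (normRB e); lra.
Qed.

Let inv_small (d : R) : 0 < d -> \forall n \near \oo, n.+1%:R^-1 < d.
Proof.
by move=> d0; have [N hN] := inv_succ_lt d0; exists N => // n /hN.
Qed.

Lemma approx_by_j (e : Hm1) : exists u : nat -> H, j (u n) @[n --> \oo] --> e.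
Proof.
have /choice [u hu] : forall n : nat, exists f, normR (j f - e) < n.+1%:R^-1.
  move=> n; case: ext => _ dj.
  have r0 : (0 : R[i]) < (n.+1%:R^-1)%:C by rewrite ltcR invr_gt0 ltr0n.
  have [||y [hy [f _ fy]]] := dj (ball e (n.+1%:R^-1)%:C).
  - by exists e; exact: ballxx.
  - exact: ball_open.
  - exists f; move: hy; rewrite -fy -ball_normE /= norm_normR ltcR.
    by rewrite normRB.
exists u; apply/cvg_normRP => d d0; apply: filterS (inv_small d0) => n.
exact: lt_trans.
Qed.

Lemma lifts_ex e : exists r, lifts e r.
Proof.
have [u ue] := approx_by_j e.
suff [r ur] : exists r : H, Rs (u n) @[n --> \oo] --> r.
  by exists r; exact: lifts_of_cauchy ur.
apply: complete_normR => d d0.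
have d2 : 0 < d / 2 by rewrite divr_gt0.
have [N _ hN] := (cvg_normRP _ _ _).1 ue _ d2.
exists N => m n Nm Nn; rewrite -RsB -j_norm linearB.
have := normR_triangle (j (u m)) e (j (u n)); rewrite (normRB e).
by have := hN _ Nm; have := hN _ Nn; rewrite /=; lra.
Qed.

(** The domain of A is dense and, on it, the resolvent is inverted explicitly. *)
Lemma lifts_surj r : exists e, lifts e r.
Proof.
have /choice [x hx] : forall n : nat, exists x, dom A x /\ normR (x - r) < n.+1%:R^-1.
  move=> n; have n0 : 0 < n.+2%:R^-1 :> R by rewrite invr_gt0 ltr0n.
  have [z Az hz] := dense_generator C0S genA r n0; exists z; split=> //.
  by rewrite (le_lt_trans hz)// ltf_pV2 ?posrE ?ltr0n// ltr_nat.
pose u n := rho0%:C *: x n - A (x n).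
have Ru n : Rs (u n) = x n by apply: Rs_inj; have [] := hx n.
have xr : x n @[n --> \oo] --> r.
  apply/cvg_normRP => d d0; apply: filterS (inv_small d0) => n.
  by apply: lt_trans; have [] := hx n.
suff [e ue] : exists e : Hm1, j (u n) @[n --> \oo] --> e.
  exists e; apply: lifts_of_cauchy ue _.
  by rewrite (_ : (fun n => Rs (u n)) = x)//; apply/funext.
apply: complete_normR => d d0.
have d2 : 0 < d / 2 by rewrite divr_gt0.
have [N _ hN] := (cvg_normRP _ _ _).1 xr _ d2.
exists N => m n Nm Nn; rewrite -linearB j_norm RsB !Ru.
have := normR_triangle (x m) r (x n); rewrite (normRB r).
by have := hN _ Nm; have := hN _ Nn; rewrite /=; lra.
Qed.

Lemma lifts_j f : lifts (j f) (Rs f).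
Proof. by move=> d d0; exists f; rewrite !subrr !normR0. Qed.

Lemma liftsD e1 e2 r1 r2 : lifts e1 r1 -> lifts e2 r2 -> lifts (e1 + e2) (r1 + r2).
Proof.
move=> h1 h2 d d0; have d2 : 0 < d / 2 by rewrite divr_gt0.
have [f [fe fr]] := h1 _ d2; have [g [ge gr]] := h2 _ d2.
have aca (V : zmodType) (a b a' b' : V) : a + b - (a' + b') = (a - a') + (b - b').
  by rewrite opprD addrACA.
exists (f + g); rewrite linearD RsD !aca.
have := normRD (j f - e1) (j g - e2); have := normRD (Rs f - r1) (Rs g - r2).
by split; lra.
Qed.

Lemma lifts_norm e r : lifts e r -> normR r <= normR e.
Proof.
move=> er; apply/ler_addgt0Pr => d d0; have d2 : 0 < d / 2 by rewrite divr_gt0.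
have [f [fe fr]] := er _ d2.
have := normRD (r - Rs f) (Rs f); have := normRD (j f - e) e.
by rewrite !subrK (normRB r) -j_norm; lra.
Qed.

Lemma resolvent_adjoint psi f : dom (adjoint A) psi ->
  inner (Rs f) (rho0%:C *: psi - adjoint A psi) = inner f psi.
Proof.
move=> Apsi; have [df ef] := RsP f.
by rewrite -[in RHS]ef innerBl innerBr innerZl innerZr conjc_real (adjointP Apsi).
Qed.

(** On H the pairing is <f, psi> = <R f, (rho0 - A^* ) psi> with R the resolvent, an
    expression that extends continuously to the extrapolation space. *)
Lemma pairing_lifts e r psi : dom (adjoint A) psi -> lifts e r ->
  pairing j e psi = inner r (rho0%:C *: psi - adjoint A psi).
Proof.
move=> Apsi er; set chi := _ - _.
pose P := [set z : R[i] | forall f : nat -> H, j (f n) @[n --> \oo] --> e ->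
  (inner (f n) psi : (R[i])^o) @[n --> \oo] --> (z : (R[i])^o)].
have Pr : P (inner r chi).
  move=> f fe; under eq_fun do rewrite -resolvent_adjoint//.
  by apply: cvg_inner; exact: lifts_cvg er fe.
have [u ue] := approx_by_j e.
have := xgetI 0 Pr => /(_ u ue) h1; have h2 := Pr u ue.
exact: (cvg_unique _ h1 h2).
Qed.

Lemma pairing_j f psi : dom (adjoint A) psi -> pairing j (j f) psi = inner f psi.
Proof. by move=> Apsi; rewrite (pairing_lifts Apsi (lifts_j f)) resolvent_adjoint. Qed.

Lemma pairingD e1 e2 psi : dom (adjoint A) psi ->
  pairing j (e1 + e2) psi = pairing j e1 psi + pairing j e2 psi.
Proof.
move=> Apsi; have [r1 h1] := lifts_ex e1; have [r2 h2] := lifts_ex e2.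
rewrite (pairing_lifts Apsi (liftsD h1 h2)) innerDl.
by rewrite (pairing_lifts Apsi h1) (pairing_lifts Apsi h2).
Qed.

(** The element with lift rho0 R x - x is the value of the extension at x: on the
    domain of A this is R (A x). *)
Lemma extensionP x psi : dom (adjoint A) psi ->
  pairing j (extension j A x) psi = inner x (adjoint A psi).
Proof.
have [e he] := lifts_surj (rho0%:C *: Rs x - x).
suff Pe : [set e | forall psi, dom (adjoint A) psi ->
    pairing j e psi = inner x (adjoint A psi)] e.
  by move: psi; exact: (xgetI 0 Pe).
move=> chi Achi /=; rewrite (pairing_lifts Achi he) innerBl innerZl resolvent_adjoint//.
by rewrite innerBr innerZr conjc_real subKr.
Qed.

Let RsZ a f : Rs (a *: f) = a *: Rs f.
Proof.
have [df ef] := RsP f; have [da ea] := generatorZ C0S genA a df.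
by rewrite -(Rs_inj da) ea -[in LHS]ef scalerBr !scalerA [a * _]mulrC.
Qed.

Lemma liftsZ a e r : lifts e r -> lifts (a *: e) (a *: r).
Proof.
move=> er d d0; pose na := complex.Re `|a|.
have na0 : 0 <= na by rewrite /na normc_def sqrtr_ge0.
have a1 : 0 < na + 1 by rewrite ltr_wpDl.
have [f [fe fr]] := er _ (divr_gt0 d0 a1); exists (a *: f).
rewrite [j (a *: f)]linearZ RsZ -!scalerBr !normRZ -/na.
have small (x : R) : x < d / (na + 1) -> na * x < d.
  move=> /ltW h; rewrite (le_lt_trans (ler_wpM2l na0 h))// mulrCA gtr_pMr//.
  by rewrite ltr_pdivrMr// mul1r ltrDl.
by split; exact: small.
Qed.

(** Existence of the value of B^* is Riesz representation on the control space. *)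
Lemma control_adjointP u phi : dom (adjoint A) phi ->
  pairing j (B u) phi = inner u (control_adjoint j B phi).
Proof.
move=> Aphi; pose chi := rho0%:C *: phi - adjoint A phi.
have /choice [r hr] : forall u, exists r, lifts (B u) r by move=> v; exact: lifts_ex.
have rD v w : inner (r (v + w)) chi = inner (r v) chi + inner (r w) chi.
  rewrite -!(pairing_lifts Aphi (hr _)) linearD pairingD//.
have rZ a v : inner (r (a *: v)) chi = a * inner (r v) chi.
  have := liftsZ a (hr v); rewrite -linearZ => /(pairing_lifts Aphi).
  by rewrite (pairing_lifts Aphi (hr _)) innerZl.
have [C C0 hC] := continuous_linear_normR contB.
have [|||v hv] := @riesz R U (fun w => rin (r w) chi) (C * normR chi).
- by move=> a b; rewrite /rin rD raddfD.
- move=> a b; rewrite /rin rZ; case: (inner (r b) chi) => c d /=.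
  by rewrite mul0r subr0.
- move=> w; rewrite (le_trans (rin_norm_le _ _))// mulrAC ler_wpM2r ?normR_ge0//.
  exact: le_trans (lifts_norm (hr w)) (hC w).
suff Pv : [set v | forall u, pairing j (B u) phi = inner u v] v.
  exact: (xgetI 0 Pv).
move=> w /=; rewrite (pairing_lifts Aphi (hr w)) !innerE hv; congr Complex.
have rin_i (V : hilbertType R) (x y : V) : rin x ('i%C *: y) = - rin ('i%C *: x) y.
  rewrite /rin innerZl innerZr; case: (inner x y) => a b.
  by rewrite /=; ring.
by rewrite !rin_i -hv /rin rZ innerZl.
Qed.

(** The feedback identity lives in the extrapolation space; pairing it with an
    element of the domain of A^* brings it back to H and U. *)
Lemma closed_loop_duality (x y : H) (u : U) phi : dom (adjoint A) phi ->
  j y = extension j A x + B u ->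
  inner y phi = inner x (adjoint A phi) + inner u (control_adjoint j B phi).
Proof.
move=> Aphi jy; rewrite -(pairing_j y Aphi) jy pairingD//.
by rewrite extensionP// control_adjointP.
Qed.

End Duality.

(** * The energy of a closed-loop orbit *)

Section Energy.
Variables (R : realType) (H U : hilbertType R) (S : R -> {linear H -> H}).
Hypothesis C0S : C0_semigroup S.
Variable L : operator H H.
Hypothesis genL : generates L S.
Variables (K : H -> U) (phi psi : H) (b : U) (lambda : R[i]).
Hypothesis dual : forall z, dom L z ->
  inner (L z) phi = inner z psi + inner (K z) b.
Local Notation sigma := (complex.Re lambda).
Let a := lambda *: phi - psi.

Let energy x (t : R) : R := expR (- (2 * sigma) * t) *
  (rin (orbit S x t) phi ^+ 2 + rin (orbit S x t) ('i%C *: phi) ^+ 2).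

Let rin_bounds (V : hilbertType R) (x y : V) (M : R) : normR x <= M ->
  `|rin x y| <= M * normR y /\ `|rin x ('i%C *: y)| <= M * normR y.
Proof.
move=> xM; split; apply: le_trans (rin_norm_le _ _) _; rewrite ?normR_i;
  by rewrite ler_wpM2r ?normR_ge0.
Qed.

(** The rotation by Im lambda disappears from the derivative of the squared
    modulus, which is why the energy is used rather than the pairing itself. *)
Lemma is_derive_energy x (t : R) : dom L x -> 0 < t ->
  exists2 d, is_derive t 1 (energy x) d &
  - (4 * expR (- (2 * sigma) * t) *
     ((normR (S t x) * normR a + normR (K (S t x)) * normR b) *
      (normR (S t x) * normR phi))) <= d.
Proof.
move=> Lx t0; have [domS LS] := generator_orbit C0S genL Lx (ltW t0).
have := dual domS; rewrite LS => dualt.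
set y := S t x in domS LS dualt *.
set p := rin y phi; set q := rin y ('i%C *: phi).
pose w1 := - rin y a + rin (K y) b.
pose w2 := - rin y ('i%C *: a) + rin (K y) ('i%C *: b).
pose tau := complex.Im lambda.
have ypsi : inner y psi = lambda^*%C * inner y phi - inner y a.
  by rewrite /a innerBr innerZr subKr.
have [dp dq] : rin (S t (L x)) phi = sigma * p + tau * q + w1 /\
    rin (S t (L x)) ('i%C *: phi) = sigma * q - tau * p + w2.
  move: dualt; rewrite ypsi !innerE -/p -/q /tau /w1 /w2.
  by case: lambda => s u /= [-> ->]; split; ring.
pose P s := rin (orbit S x s) phi; pose Q s := rin (orbit S x s) ('i%C *: phi).
pose e (s : R) := expR (- (2 * sigma) * s).
have hP : is_derive t 1 P (sigma * p + tau * q + w1).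
  by rewrite -dp -(orbit_ge0 S (L x) (ltW t0)); exact: is_derive_orbit.
have hQ : is_derive t 1 Q (sigma * q - tau * p + w2).
  by rewrite -dq -(orbit_ge0 S (L x) (ltW t0)); exact: is_derive_orbit.
have he : is_derive t 1 e (e t * - (2 * sigma)).
  have hl : is_derive t 1 ( *%R (- (2 * sigma)) : R -> R) (- (2 * sigma)).
    have := is_deriveZ (- (2 * sigma)) (is_derive_id t (1 : R)).
    by rewrite /GRing.scale /= mulr1.
  have := @is_derive1_comp R expR _ t _ _ (is_derive_expR _) hl.
  by [].
exists (e t * (2 * (p * w1 + q * w2))).
  have -> : energy x = e * (P * P + Q * Q).
    by apply/funext => r; rewrite /energy !expr2.
  apply: is_derive_eq.
  rewrite /GRing.scale /= -/(P t) /P /Q !orbit_ge0 ?(ltW t0)// -/y -/p -/q.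
  rewrite -[(_ * _ + _ * _) t]/(P t * P t + Q t * Q t) /P /Q orbit_ge0 ?(ltW t0)//.
  by rewrite -/y -/p -/q; ring.
set W := normR y * normR a + _; set Y := normR y * normR phi.
have -> : 4 * expR (- (2 * sigma) * t) * (W * Y) = e t * (4 * (W * Y)).
  by rewrite /e; ring.
rewrite -mulrN ler_pM2l ?expR_gt0//.
have [hp hq] := rin_bounds phi (lexx (normR y)).
have [ya yia] := rin_bounds a (lexx (normR y)).
have [Kb Kib] := rin_bounds b (lexx (normR (K y))).
have hw1 : `|w1| <= W by rewrite (le_trans (ler_normD _ _))// normrN lerD.
have hw2 : `|w2| <= W by rewrite (le_trans (ler_normD _ _))// normrN lerD.
have h1 : `|p * w1| <= Y * W by rewrite normrM ler_pM.
have h2 : `|q * w2| <= Y * W by rewrite normrM ler_pM.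
move: h1 h2; rewrite !ler_norml => /andP[h1 _] /andP[h2 _]; lra.
Qed.

(** Any primitive G of a majorant of the dissipation bounds the loss of energy. *)
Lemma energy_le x (G g : R -> R) (T : R) : dom L x -> 0 < T ->
  (forall t, 0 < t < T -> is_derive t 1 G (g t)) ->
  {within `[0, T], continuous G} ->
  (forall t, 0 < t < T ->
    4 * expR (- (2 * sigma) * t) *
     ((normR (S t x) * normR a + normR (K (S t x)) * normR b) *
      (normR (S t x) * normR phi)) <= g t) ->
  rin x phi ^+ 2 <= 2 * expR (- (2 * sigma) * T) * (normR (S T x) * normR phi) ^+ 2
                     + (G T - G 0).
Proof.
move=> Lx T0 dG cG hg.
have cE : continuous (energy x).
  move=> t; apply: cvgM.
    apply: continuous_comp; last exact: continuous_expR.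
    by apply: cvgM; [exact: cvg_cst|exact: cvg_id].
  by apply: cvgD; apply: cvgM; apply: cvg_rinl; exact: orbit_continuous.
have cEG : {within `[0, T], continuous (energy x + G)}.
  by move=> t; apply: cvgD; [exact: continuous_subspaceT|exact: cG].
have mono : energy x 0 + G 0 <= energy x T + G T.
  have dEG t : t \in `]0, T[ -> derivable (energy x + G) t 1 /\
      0 <= derive1 (energy x + G) t.
    rewrite in_itv/= => tT; have /andP[t0 _] := tT.
    have [d dE hd] := is_derive_energy Lx t0.
    have dEG := is_deriveD dE (dG t tT); split; first by case: dEG.
    rewrite derive1E derive_val; have := hg t tT; lra.
  have in0 : 0 \in `[0, T] by rewrite in_itv/= lexx (ltW T0).
  have inT : T \in `[0, T] by rewrite in_itv/= lexx (ltW T0).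
  have d1 t (tT : t \in `]0, T[) := (dEG t tT).1.
  have d2 t (tT : t \in `]0, T[) := (dEG t tT).2.
  exact: (ger0_derive1_le_cc d1 d2 cEG in0 inT (ltW T0)).
have ET : energy x T <= 2 * expR (- (2 * sigma) * T) * (normR (S T x) * normR phi) ^+ 2.
  rewrite /energy -mulrA mulrCA ler_pM2l ?expR_gt0// orbit_ge0 ?(ltW T0)//.
  have [h1 h2] := rin_bounds phi (lexx (normR (S T x))).
  set Y := _ * _ in h1 h2 *.
  have sq (r : R) : `|r| <= Y -> r ^+ 2 <= Y ^+ 2.
    by move=> h; rewrite -real_normK ?num_real// lerXn2r ?nnegrE// (le_trans _ h).
  have := sq _ h1; have := sq _ h2; lra.
have E0 : rin x phi ^+ 2 <= energy x 0.
  rewrite /energy mulr0 expR0 mul1r orbit_ge0//.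
  by case: C0S => _ -> _ _; rewrite lerDl sqr_ge0.
lra.
Qed.

(** The bound at x close to phi gives |phi|^2 <= |phi| sqrt Q in the limit. *)
Lemma density_test (Q : R) : 0 <= Q ->
  (forall x, dom L x -> rin x phi ^+ 2 <= normR x ^+ 2 * Q) -> normR phi ^+ 2 <= Q.
Proof.
move=> Q0 hx; have q0 := sqrtr_ge0 Q.
have {}hx x : dom L x -> rin x phi <= normR x * Num.sqrt Q.
  move=> /hx; rewrite -[X in _ * X](sqr_sqrtr Q0) -exprMn => h.
  rewrite (le_trans (ler_norm _))// -(ler_pXn2r (n := 2)) ?nnegrE//.
    by rewrite real_normK ?num_real.
  by rewrite mulr_ge0 ?normR_ge0.
suff : normR phi <= Num.sqrt Q.
  by move=> h; rewrite -(sqr_sqrtr Q0) lerXn2r ?nnegrE ?normR_ge0.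
have [p0|p0] := eqVneq (normR phi) 0; first by rewrite p0.
have pp : 0 < normR phi by rewrite lt_def p0 normR_ge0.
rewrite -(ler_pM2l pp) -expr2 -rin_norm.
apply/ler_addgt0Pr => e e0.
have k0 : 0 < Num.sqrt Q + normR phi by rewrite ltr_wpDl.
have [x Lx xphi] := dense_generator C0S genL phi (divr_gt0 e0 k0).
have h1 : rin (phi - x) phi <= e / (Num.sqrt Q + normR phi) * normR phi.
  rewrite (le_trans (rin_le _ _))// normRB ler_wpM2r ?normR_ge0//.
have h2 : normR x * Num.sqrt Q <=
    (normR phi + e / (Num.sqrt Q + normR phi)) * Num.sqrt Q.
  rewrite ler_wpM2r//; have := normRD (x - phi) phi; rewrite subrK; lra.
have -> : e = e / (Num.sqrt Q + normR phi) * (Num.sqrt Q + normR phi).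
  by rewrite divfK ?gt_eqF.
have := hx x Lx; move: h1; rewrite rinBl; lra.
Qed.

End Energy.

(** * High frequencies and the output of the closed loop *)

(** For Re lambda large, the weight makes the energy at time 1 at most half of
    |x|^2 |phi|^2 whatever the growth of the semigroup, and the dissipation
    integrates exp(-2 Re(lambda) t), which gains the factor 1 / Re lambda. *)
Lemma high_frequency_estimate (R : realType) (H : hilbertType R)
    (S : R -> {linear H -> H}) (L : operator H H) :
  C0_semigroup S -> generates L S ->
  exists s0 C : R, [/\ 1 <= s0, 0 < C & forall (lambda : R[i]) (phi : H),
    s0 <= complex.Re lambda -> dom (adjoint L) phi ->
    normR phi <= C / complex.Re lambda * normR (lambda *: phi - adjoint L phi)].
Proof.
move=> C0S genL; have [M M0 hM] := semigroup_locally_bounded C0S 1.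
have M20 : 0 < M ^+ 2 by rewrite exprn_gt0.
(* With this threshold, 1 + 2 s <= exp(2 s) gives 2 M^2 exp(-2 s) <= 1/2. *)
exists (1 + 4 * M ^+ 2), (4 * M ^+ 2); split; [lra|lra|] => lambda phi hs Lphi.
set a := normR (_ - _); set s := complex.Re lambda in hs *.
have a0 : 0 <= a := normR_ge0 _.
have s0 : 0 < s by lra.
pose n := normR phi; have n0 : 0 <= n := normR_ge0 _.
pose Q := 2 * expR (- (2 * s)) * M ^+ 2 * n ^+ 2 + 2 / s * M ^+ 2 * a * n.
have Q0 : 0 <= Q.
  by rewrite /Q addr_ge0// !mulr_ge0// ?expR_ge0 ?invr_ge0 ?(ltW s0) ?(ltW M0).
have : n ^+ 2 <= Q.
  apply: (density_test C0S genL Q0) => x Lx.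
  pose c := 4 * M ^+ 2 * normR x ^+ 2 * a * n.
  have c0 : 0 <= c by rewrite /c !mulr_ge0// ?normR_ge0 ?(ltW M0).
  pose e (t : R) := expR (- (2 * s) * t).
  pose G t := - (c / (2 * s)) * e t.
  have dG (t : R) : is_derive t 1 G (c * e t).
    have hl : is_derive t 1 ( *%R (- (2 * s)) : R -> R) (- (2 * s)).
      have := is_deriveZ (- (2 * s)) (is_derive_id t (1 : R)).
      by rewrite /GRing.scale /= mulr1.
    have he : is_derive t 1 e (e t * - (2 * s)).
      exact: (@is_derive1_comp R expR _ t _ _ (is_derive_expR _) hl).
    have := is_deriveZ (- (c / (2 * s))) he.
    rewrite /GRing.scale /=; congr (is_derive _ _ _ _).
    by field; rewrite gt_eqF.
  have dual z : dom L z -> inner (L z) phi = inner z (adjoint L phi) + inner (0 : H) (0 : H).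
    by move=> Lz; rewrite (adjointP Lphi Lz) linear0r addr0.
  have cG : {within `[0, 1], continuous G}.
    by apply: derivable_within_continuous => t _; case: (dG t).
  have hg t : 0 < t < 1 -> 4 * e t *
      ((normR (S t x) * a + normR (0 : H) * normR (0 : H)) * (normR (S t x) * n)) <= c * e t.
  - move=> /andP[t0 t1]; rewrite normR0 mul0r addr0.
    have h : normR (S t x) <= M * normR x by apply: hM; rewrite !ltW.
    have h2 : normR (S t x) ^+ 2 <= M ^+ 2 * normR x ^+ 2.
      by rewrite -exprMn lerXn2r ?nnegrE ?mulr_ge0 ?normR_ge0 ?(ltW M0).
    rewrite (_ : 4 * e t * _ = e t * (4 * a * n) * normR (S t x) ^+ 2); last by ring.
    rewrite (_ : c * e t = e t * (4 * a * n) * (M ^+ 2 * normR x ^+ 2)); last first.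
      by rewrite /c; ring.
    by rewrite ler_wpM2l// !mulr_ge0 ?expR_ge0.
  have := energy_le (K := fun _ => 0) C0S genL dual Lx ltr01 (fun t _ => dG t) cG hg.
  rewrite -/s mulr1 -/n => h; apply: le_trans h _.
  have h2 : (normR (S 1 x) * n) ^+ 2 <= M ^+ 2 * normR x ^+ 2 * n ^+ 2.
    rewrite -!exprMn lerXn2r ?nnegrE ?mulr_ge0 ?normR_ge0 ?(ltW M0)//.
    by rewrite ler_wpM2r// hM// lexx ler01.
  have := ler_wpM2l (expR_ge0 (- (2 * s))) h2.
  have : G 1 - G 0 <= c / (2 * s).
    have e0 : e 0 = 1 by rewrite /e mulr0 expR0.
    have h3 : 0 <= c / (2 * s) * e 1.
      by rewrite mulr_ge0 ?expR_ge0// divr_ge0// mulr_ge0// ltW.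
    by rewrite /G e0; lra.
  rewrite (_ : c / (2 * s) = normR x ^+ 2 * (2 / s * M ^+ 2 * a * n)); last first.
    by rewrite /c; field; rewrite gt_eqF.
  rewrite /Q; lra.
have eM : 2 * expR (- (2 * s)) * M ^+ 2 <= 2^-1.
  have h1 : 1 + 2 * s <= expR (2 * s) by rewrite expR_ge1Dx// mulr_ge0// ltW.
  rewrite expRN mulrAC ler_pdivrMr ?expR_gt0//; lra.
have {}eM := ler_wpM2r (sqr_ge0 n) eM.
rewrite /Q => hQ.
have {hQ} : n ^+ 2 <= 4 / s * M ^+ 2 * a * n.
  have -> : 4 / s * M ^+ 2 * a * n = 2 * (2 / s * M ^+ 2 * a * n).
    by field; rewrite gt_eqF.
  lra.
rewrite -/n; have [-> _|nn] := eqVneq n 0.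
  by rewrite mulr_ge0// divr_ge0 ?(ltW s0)// mulr_ge0 ?(ltW M20).
have np : 0 < n by rewrite lt_def nn.
rewrite expr2 ler_pM2r// => h; apply: le_trans h _.
by rewrite le_eqVlt; apply/orP; left; apply/eqP; ring.
Qed.

Definition output_sq (R : realType) (H U : hilbertType R) (S : R -> {linear H -> H})
  (K : H -> U) (x : H) (t : R) : R := normR (K (orbit S x t)) ^+ 2.

Section Output.
Variables (R : realType) (H U : hilbertType R) (S : R -> {linear H -> H}).
Hypothesis C0S : C0_semigroup S.
Variable L : operator H H.
Hypothesis genL : generates L S.
Variable K : H -> U.
Hypothesis bK : bounded_on_domain L K.

Lemma output_continuous x : dom L x -> continuous (fun t => K (orbit S x t)).
Proof.
move=> Lx t; have [Klin [M hM]] := bK.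
have dorb (s : R) : dom L (orbit S x s) /\ L (orbit S x s) = orbit S (L x) s.
  by apply: generator_orbit; rewrite // le_max lexx orbT.
apply/cvg_normRP => e e0.
have M1 : 0 < `|M| + 1 by rewrite ltr_wpDl.
have e2 : 0 < e / (`|M| + 1) / 2 by rewrite !divr_gt0.
move/cvg_normRP : (@orbit_continuous _ _ _ C0S (L x) t) => /(_ _ e2).
move/cvg_normRP : (@orbit_continuous _ _ _ C0S x t) => /(_ _ e2).
apply: filterS2 => s h1 h2.
have [ds Ls] := dorb s; have [dt Lt] := dorb t.
have [dst Lst] := generatorB C0S genL ds dt.
have -> : K (orbit S x s) - K (orbit S x t) = K (orbit S x s - orbit S x t).
  by rewrite -[in RHS]scaleN1r [in RHS]addrC Klin// scaleN1r addrC.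
rewrite (le_lt_trans (hM _ dst))// /graph_norm Lst Ls Lt.
set g := _ + _; have g0 : 0 <= g by rewrite addr_ge0 ?normR_ge0.
have gl : g < e / (`|M| + 1) by rewrite [ltRHS]splitr ltrD.
rewrite (@le_lt_trans _ _ ((`|M| + 1) * g))//.
  by rewrite ler_wpM2r// (le_trans (ler_norm M))// lerDl.
by rewrite -ltr_pdivlMl// mulrC.
Qed.

Lemma output_sq_continuous x : dom L x -> continuous (output_sq S K x).
Proof.
move=> Lx t; rewrite /output_sq; apply: cvgM; apply: cvg_normR; exact: output_continuous.
Qed.

(** The L2 bound of the output, in the form needed by [energy_le]: an increment
    of a primitive. *)
Lemma output_energy x (C T : R) : dom L x -> 0 < T ->
  (L2norm (fun t => K (S t x)) <= C%:E)%E ->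
  prim (output_sq S K x) T - prim (output_sq S K x) 0 <= C ^+ 2.
Proof.
move=> Lx T0 hC; set k2 := output_sq S K x.
have ck2 : continuous k2 by exact: output_sq_continuous.
have mk2 D : measurable_fun D (EFin \o k2).
  by apply/measurable_EFinP/measurable_funTS; exact: continuous_measurable_fun.
rewrite -lee_fin -integral_prim//.
have -> : (\int[lebesgue_measure]_(s in `[0%R, T]) (k2 s)%:E =
    \int[lebesgue_measure]_(s in `]0%R, T]) (k2 s)%:E)%E.
  rewrite integral_itv_obnd_cbnd//.
apply: (@le_trans _ _ (\int[lebesgue_measure]_(s in `]0%R, +oo[) (k2 s)%:E)%E).
  apply: ge0_subset_integral => //.
  - exact: mk2.
  - by move=> t _; rewrite lee_fin sqr_ge0.
  - by move=> t /=; rewrite !in_itv/= => /andP[-> _].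
move: hC; rewrite /L2norm.
have -> : (\int[lebesgue_measure]_(t in `]0%R, +oo[) (normR (K (S t x)) ^+ 2)%:E =
  \int[lebesgue_measure]_(t in `]0%R, +oo[) (k2 t)%:E)%E.
  apply: eq_integral => t; rewrite inE /= in_itv/= andbT => t0.
  by rewrite /k2 /output_sq orbit_ge0// ltW.
have : (0 <= \int[lebesgue_measure]_(t in `]0%R, +oo[) (k2 t)%:E)%E.
  by apply: integral_ge0 => t _; rewrite lee_fin sqr_ge0.
case: (\int[lebesgue_measure]_(t in `]0%R, +oo[) (k2 t)%:E)%E => [i| |] //.
- rewrite lee_fin => i0; rewrite poweR_EFin powR12_sqrt// !lee_fin => h.
  rewrite -(sqr_sqrtr i0) lerXn2r ?nnegrE ?sqrtr_ge0//.
  exact: le_trans h.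
- by rewrite poweRyr ?invr_eq0// leye_eq.
Qed.

End Output.

(** * The resolvent estimate for the stabilized system *)

(** The energy estimate on a fixed interval [0, T], uniform in the half-plane
    Re lambda > -beta because exp(-2 Re(lambda) t) <= exp(2 beta T) there. The
    product of the output with B^* phi is split by Young's inequality, with eps
    small enough to absorb the output energy into |phi|^2. *)
Lemma damped_estimate (R : realType) (H U : hilbertType R)
    (S : R -> {linear H -> H}) (L : operator H H) (K : H -> U)
    (alpha beta C1 C2 : R) :
  C0_semigroup S -> generates L S -> bounded_on_domain L K ->
  0 < beta -> beta < alpha -> 0 < C1 -> 0 < C2 ->
  (forall t, 0 < t -> forall x,
     normR (S t x) <= C1 * expR (- alpha * t) * normR x) ->
  (forall x, dom L x -> (L2norm (fun t => K (S t x)) <= (C2 * normR x)%:E)%E) ->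
  exists2 D : R, 0 < D & forall (lambda : R[i]) (phi psi : H) (b : U),
    - beta < complex.Re lambda ->
    (forall z, dom L z -> inner (L z) phi = inner z psi + inner (K z) b) ->
    normR phi ^+ 2 <= D * (normR (lambda *: phi - psi) ^+ 2 + normR b ^+ 2).
Proof.
move=> C0S genL bK beta0 ab C10 C20 hC1 hC2.
have ab0 : 0 < alpha - beta by lra.
have C12 : 0 < C1 ^+ 2 by rewrite exprn_gt0.
(* T is such that 2 C1^2 exp(-2 (alpha - beta) T) <= 1/2, by 1 + y <= exp y. *)
have [T T0 hT] : exists2 T, 0 < T & 2 * (alpha - beta) * T = 4 * C1 ^+ 2.
  exists (2 * C1 ^+ 2 / (alpha - beta)); first by rewrite divr_gt0// mulr_gt0.
  by field; rewrite gt_eqF.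
pose E := expR (2 * beta * T); have E0 : 0 < E by exact: expR_gt0.
have E4 : 0 < 4 * E * C1 by rewrite !mulr_gt0.
(* The coefficient 2 E C1 eps C2^2 of |phi|^2 in the output term becomes 1/8. *)
pose eps := (16 * E * C1 * C2 ^+ 2)^-1.
have eps0 : 0 < eps by rewrite invr_gt0 !mulr_gt0// exprn_gt0.
pose P := 4 * E * C1 ^+ 2 * T; have P0 : 0 < P by rewrite !mulr_gt0//.
pose P' := 2 * E * C1 * T / eps; have P'0 : 0 < P' by rewrite divr_gt0// !mulr_gt0//.
exists (8 * P ^+ 2 + 4 * P') => [|lambda phi psi b hs dual].
  by rewrite addr_gt0// mulr_gt0// exprn_gt0.
set s := complex.Re lambda in hs *.
set a := normR (lambda *: phi - psi); set d := normR b.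
have a0 : 0 <= a := normR_ge0 _.
have d0 : 0 <= d := normR_ge0 _.
pose n := normR phi; have n0 : 0 <= n := normR_ge0 _.
pose Q := 2^-1 * n ^+ 2 + P * a * n + 8^-1 * n ^+ 2 + P' * d ^+ 2.
have Q0 : 0 <= Q.
  have q1 : 0 <= P * a * n by rewrite mulr_ge0// mulr_ge0// ltW.
  have q2 : 0 <= P' * d ^+ 2 by rewrite mulr_ge0 ?sqr_ge0// ltW.
  have q3 := sqr_ge0 n; rewrite /Q; lra.
have expE t : 0 < t <= T -> expR (- (2 * s) * t) <= E.
  move=> /andP[t0 tT]; rewrite ler_expR; nra.
have decay : 2 * C1 ^+ 2 * (E * expR (- alpha * T) ^+ 2) <= 2^-1.
  have -> : E * expR (- alpha * T) ^+ 2 = expR (- (2 * (alpha - beta) * T)).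
    by rewrite expr2 /E -!expRD; congr expR; ring.
  have h1 : 1 + 2 * (alpha - beta) * T <= expR (2 * (alpha - beta) * T).
    by rewrite expR_ge1Dx// !mulr_ge0// ?(ltW ab0) ?(ltW T0).
  rewrite expRN ler_pdivrMr ?expR_gt0//; lra.
have : n ^+ 2 <= Q.
  apply: (density_test C0S genL Q0) => x Lx.
  pose X := normR x; have X0 : 0 <= X := normR_ge0 _.
  pose c1 := 4 * E * C1 * (C1 * X ^+ 2 * a * n + X ^+ 2 * d ^+ 2 / (2 * eps)).
  pose c2 := 4 * E * C1 * (eps * n ^+ 2 / 2).
  have c20 : 0 <= c2.
    by rewrite mulr_ge0 ?(ltW E4)// divr_ge0// mulr_ge0 ?sqr_ge0 ?(ltW eps0).
  pose k2 := output_sq S K x.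
  have ck2 : continuous k2 by exact: (output_sq_continuous C0S genL bK Lx).
  pose G (t : R) := c1 * t + c2 * prim k2 t.
  have dG (t : R) : -1 < t -> is_derive t 1 G (c1 + c2 * k2 t).
    move=> t1; have dp := is_derive_prim ck2 t1.
    have := is_deriveD (is_deriveZ c1 (is_derive_id t (1 : R))) (is_deriveZ c2 dp).
    by rewrite /GRing.scale /= mulr1.
  have cG : {within `[0, T], continuous G}.
    apply: derivable_within_continuous => t; rewrite in_itv/= => /andP[t0 _].
    by case: (dG t (lt_le_trans (ltrN10 R) t0)).
  have SX t : 0 < t -> normR (S t x) <= C1 * X.
    move=> t0; rewrite (le_trans (hC1 _ t0 x))// ler_wpM2r// ler_piMr ?(ltW C10)//.
    by rewrite -expR0 ler_expR mulNr oppr_le0 mulr_ge0// ltW// (lt_trans beta0).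
  have hg t : 0 < t < T -> 4 * expR (- (2 * s) * t) *
      ((normR (S t x) * a + normR (K (S t x)) * d) * (normR (S t x) * n))
      <= c1 + c2 * k2 t.
    move=> /andP[t0 tT]; have et : expR (- (2 * s) * t) <= E.
      by apply: expE; rewrite t0 ltW.
    pose k := normR (K (S t x)); have k0 : 0 <= k := normR_ge0 _.
    have -> : k2 t = k ^+ 2 by rewrite /k2 /output_sq orbit_ge0// ltW.
    rewrite -/k; have h1 := SX t t0.
    have young : k * d * (X * n) <= (eps * k ^+ 2 * n ^+ 2 + X ^+ 2 * d ^+ 2 / eps) / 2.
      rewrite -subr_ge0.
      rewrite (_ : _ - _ = (eps * k * n - X * d) ^+ 2 / (2 * eps)); last first.
        by field; rewrite gt_eqF.
      by rewrite divr_ge0 ?sqr_ge0// mulr_ge0// ltW.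
    apply: (@le_trans _ _ (4 * E * ((C1 * X * a + k * d) * (C1 * X * n)))).
      have S0 := normR_ge0 (S t x).
      apply: ler_pM; rewrite ?mulr_ge0 ?addr_ge0 ?mulr_ge0 ?expR_ge0//.
        by rewrite ler_pM2l.
      apply: ler_pM; rewrite ?addr_ge0 ?mulr_ge0//.
        by rewrite lerD2r ler_wpM2r.
      by rewrite ler_wpM2r.
    have := ler_wpM2l (ltW E4) young.
    rewrite /c1 /c2 => h.
    rewrite (_ : 4 * E * _ = 4 * E * C1 * (C1 * X ^+ 2 * a * n) +
      4 * E * C1 * (k * d * (X * n))); last by ring.
    rewrite (_ : _ + _ * k ^+ 2 = 4 * E * C1 * (C1 * X ^+ 2 * a * n) +
      4 * E * C1 * ((eps * k ^+ 2 * n ^+ 2 + X ^+ 2 * d ^+ 2 / eps) / 2)); last first.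
      by field; rewrite gt_eqF.
    by rewrite lerD2l.
  have dG' t : 0 < t < T -> is_derive t 1 G (c1 + c2 * k2 t).
    by move=> /andP[t0 _]; apply: dG; lra.
  have := energy_le C0S genL dual Lx T0 dG' cG hg.
  rewrite -/s -/n => h; apply: le_trans h _.
  have hST : 2 * expR (- (2 * s) * T) * (normR (S T x) * n) ^+ 2 <=
      2^-1 * n ^+ 2 * X ^+ 2.
    apply: (@le_trans _ _ (2 * E * (C1 * expR (- alpha * T) * X * n) ^+ 2)).
      apply: ler_pM; rewrite ?mulr_ge0 ?expR_ge0 ?normR_ge0 ?sqr_ge0//.
        by rewrite ler_pM2l// expE// T0 lexx.
      rewrite lerXn2r ?nnegrE ?mulr_ge0 ?normR_ge0 ?expR_ge0 ?(ltW C10)//.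
      by rewrite ler_wpM2r// hC1.
    have := ler_wpM2r (mulr_ge0 (sqr_ge0 n) (sqr_ge0 X)) decay.
    rewrite [leRHS]mulrA; apply: le_trans.
    by rewrite le_eqVlt; apply/orP; left; apply/eqP; ring.
  have hk := output_energy C0S genL bK Lx T0 (hC2 x Lx).
  have := ler_wpM2l c20 hk; rewrite -/k2 -/X => hk2.
  have -> : X ^+ 2 * Q = 2^-1 * n ^+ 2 * X ^+ 2 + (c1 * T + c2 * (C2 * X) ^+ 2).
    by rewrite /Q /P /P' /c1 /c2 /eps; field; rewrite !gt_eqF.
  apply: lerD hST _; rewrite /G mulr0; lra.
have young : P * a * n <= 8^-1 * n ^+ 2 + 2 * P ^+ 2 * a ^+ 2.
  rewrite -subr_ge0 (_ : _ - _ = 2 * (P * a - 4^-1 * n) ^+ 2); last by field.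
  by rewrite mulr_ge0// sqr_ge0.
rewrite /Q -/n => h.
have h3 : 0 <= P ^+ 2 * d ^+ 2 by rewrite mulr_ge0 ?sqr_ge0.
have h4 : 0 <= P' * a ^+ 2 by rewrite mulr_ge0 ?sqr_ge0 ?(ltW P'0).
lra.
Qed.

(** [damped_estimate] serves for Re lambda <= s0, where Re lambda + beta is
    bounded, and [high_frequency_estimate] for the remaining frequencies. *)
Lemma stabilizable_HESI (R : realType) (H U : hilbertType R)
    (A : operator H H) (S : R -> {linear H -> H}) (rho0 : R)
    (Hm1 : completeNormedModType R[i]) (j : {linear H -> Hm1})
    (B : {linear U -> Hm1}) (alpha beta : R) :
  C0_semigroup S -> generates A S -> resolvent_set A rho0%:C ->
  extrapolation_space j A rho0 -> continuous B ->
  stabilizable_with_rate j A B alpha -> 0 < beta -> beta < alpha ->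
  HESI_at j A B beta.
Proof.
move=> C0S genA resA ext contB.
move=> [Sd [L [K [[C0Sd genL] bK [C1 C10 hC1] loop [C2 C20 hC2]]]]].
move=> beta0 ab.
have [D D0 hD] := damped_estimate C0Sd genL bK beta0 ab C10 C20 hC1 hC2.
have [s0 [C [s01 C0 hC]]] := high_frequency_estimate C0S genA.
exists (D * (s0 + beta) ^+ 2 + C ^+ 2 * (1 + beta) ^+ 2).
  by rewrite addr_gt0// mulr_gt0// exprn_gt0//; lra.
move=> lambda phi hs Aphi; set s := complex.Re lambda in hs *.
set a := normR (lambda *: phi - _); set d := normR (control_adjoint j B phi).
have sb : 0 < s + beta by lra.
have sb2 : 0 < (s + beta) ^+ 2 by rewrite exprn_gt0.
have W0 : 0 <= a ^+ 2 + d ^+ 2 by rewrite addr_ge0 ?sqr_ge0.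
rewrite mulrAC ler_pdivlMr//.
have [ss|ss] := leP s s0.
  have dual z : dom L z -> inner (L z) phi =
      inner z (adjoint A phi) + inner (K z) (control_adjoint j B phi).
    by move=> Lz; exact: (closed_loop_duality C0S genA resA ext contB Aphi (loop z Lz)).
  have h := hD lambda phi _ _ hs dual.
  apply: le_trans (ler_wpM2r (ltW sb2) h) _.
  rewrite -/a -/d mulrAC ler_wpM2r//.
  apply: (@le_trans _ _ (D * (s0 + beta) ^+ 2)); last by rewrite lerDl mulr_ge0 ?sqr_ge0.
  rewrite ler_pM2l// lerXn2r ?nnegrE ?(ltW sb)//; lra.
have s_gt0 : 0 < s by lra.
have h := hC lambda phi (ltW ss) Aphi; rewrite -/s -/a in h.
have a0 : 0 <= a := normR_ge0 _.
have h2 : normR phi * (s + beta) <= C * (1 + beta) * a.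
  apply: (le_trans (ler_wpM2r (ltW sb) h)).
  rewrite (_ : _ / _ * _ * _ = C * a * ((s + beta) / s)); last by field; rewrite gt_eqF.
  rewrite (_ : C * (1 + beta) * a = C * a * (1 + beta)); last by ring.
  rewrite ler_wpM2l ?mulr_ge0 ?(ltW C0)// ler_pdivrMr//; nra.
rewrite -exprMn; apply: (@le_trans _ _ ((C * (1 + beta) * a) ^+ 2)).
  by rewrite lerXn2r ?nnegrE ?mulr_ge0 ?normR_ge0 ?(ltW sb) ?addr_ge0 ?(ltW C0) ?(ltW beta0).
rewrite !exprMn.
apply: (@le_trans _ _ (C ^+ 2 * (1 + beta) ^+ 2 * (a ^+ 2 + d ^+ 2))).
  by rewrite ler_wpM2l ?lerDl ?sqr_ge0// mulr_ge0 ?sqr_ge0.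
by rewrite ler_wpM2r// lerDr mulr_ge0 ?sqr_ge0 ?(ltW D0).
Qed.

Unset Implicit Arguments.
Set Strict Implicit.

Theorem theorem1p14 (R : realType) (H U : hilbertType R)
  (sepH : separable H) (sepU : separable U)
  (A : operator H H) (S : R -> {linear H -> H})
  (A1_semigroup : C0_semigroup S) (A1_generator : generates A S)
  (rho0 : R) (rho0_gt0 : 0 < rho0) (rho0_resolvent : resolvent_set A rho0%:C)
  (Hm1 : completeNormedModType R[i]) (j : {linear H -> Hm1})
  (Hm1_completion : extrapolation_space j A rho0)
  (B : {linear U -> Hm1}) (A2_bounded : continuous B)
  (A3 : admissible j A B S) :
  (stabilizable j A B -> exists2 beta : R, 0 < beta & HESI_at j A B beta) /\
  (rapidly_stabilizable j A B -> HESI j A B).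
Proof.
have main alpha beta : stabilizable_with_rate j A B alpha -> 0 < beta ->
    beta < alpha -> HESI_at j A B beta.
  exact: (stabilizable_HESI A1_semigroup A1_generator rho0_resolvent Hm1_completion).
split=> [[alpha alpha0 stab]|stab beta beta0].
  have b0 : 0 < alpha / 2 by rewrite divr_gt0.
  by exists (alpha / 2) => //; apply: (main alpha) => //; lra.
by apply: (main (2 * beta)) => //; [apply: stab; lra | lra].
Qed.
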